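(* For a geometrically consistent dimer model on a torus, the extremal perfect matchings are precisely the perfect matchings of the form $P(\sigma)$ for all two dimensional cones $\sigma$ of the global zig-zag fan $\Xi$.
   Context: **Dimer model and quiver.** A dimer model on a torus $T$ is a finite bipartite tiling of $T$: a finite polygonal cell decomposition whose vertices (all of valence at least 2) are coloured black and white so that every edge joins a black vertex to a white vertex. The associated quiver $Q$ is the dual cell decomposition: its set of vertices $Q_0$ is dual to the tiles, its set of arrows $Q_1$ is dual to the edges, and its set of faces $Q_2$ is dual to the dimer vertices; each arrow is oriented so that the black dimer vertex is on its left and the white one on its right. Faces dual to black (white) vertices are called black (white) faces; their boundaries are oriented cycles. An arrow $a$ has tail $ta$ and head $ha$. $\widetilde{Q}$ denotes the lift of $Q$ to the universal cover of $T$. Write $H_1(Q)=H_1(T;\mathbb{Z})$. **Perfect matchings.** $\mathbb{Z}^{Q_i}$ denotes integer functions on $Q_i$. Let $d:\mathbb{Z}^{Q_0}\to\mathbb{Z}^{Q_1}$, $(dg)(a)=g(ha)-g(ta)$, and $d:\mathbb{Z}^{Q_1}\to\mathbb{Z}^{Q_2}$, $(dv)(f)=\sum_{a\in\partial f}v(a)$. Let $\underline{1}\in\mathbb{Z}^{Q_2}$ be the constant function 1 and $N=\{v\in\mathbb{Z}^{Q_1}: dv\in\mathbb{Z}\underline{1}\}$. A perfect matching is an element $\pi\in\mathbb{N}^{Q_1}$ with $d\pi=\underline{1}$. Let $N_o=N/d(\mathbb{Z}^{Q_0})$ (rank 3). The images of the perfect matchings in $N_o$ lie in a rank 2 affine sublattice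 and their convex hull is a lattice polygon. A perfect matching is extremal if its image is a vertex of this polygon. **Geometric consistency.** The quad graph is the tiling of $T$ whose vertices are the dimer vertices together with the quiver vertices, with edges connecting a dimer vertex $f$ to a quiver vertex $v$ when the quiver face dual to $f$ has $v$ in its boundary; its faces are quadrilaterals. The dimer model is geometrically consistent if, for some flat metric on the torus, its quad graph has a rhombic embedding, i.e. an embedding in the torus such that all edges are line segments of the same length. **Zig-zag flows.** A zig-zag flow is a map $\widetilde{\eta}:\mathbb{Z}\to\widetilde{Q}_1$ such that for every $n$: $h\widetilde{\eta}_n=t\widetilde{\eta}_{n+1}$; $\widetilde{\eta}_{2n},\widetilde{\eta}_{2n+1}$ are in the boundary of the same black face; $\widetilde{\eta}_{2n-1},\widetilde{\eta}_{2n}$ are in the boundary of the same white face. Flows are taken up to shifting the index by an even integer. Projecting to $Q$ gives a periodic zig-zag path $\eta$; $[\eta]\in H_1(Q)$ is the class of the sum of its arrows over a single period; it is non-zero and primitive under geometric consistency. $\widetilde\eta$ is a representative of a ray $\gamma$ if $[\eta]$ is the primitive generator of $\gamma$. **Zig-zag fans.** For a face $f$, the local zig-zag fan $\xi(f)$ is the complete fan in $H_1(Q)\otimes\mathbb{R}$ whose rays are generated by the classes of those zig-zag flows which contain an arrow of the boundary of (a lift to $\widetilde{Q}$ of) $f$. The global zig-zag fan $\Xi$ is the fan whose rays are generated by the classes of all zig-zag flows; it refines every $\xi(f)$. **The matchings $P(\sigma)$.** Under geometric consistency each ray of $\xi(f)$ has a unique representative flow meeting the boundary of (a fixed lift of)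 $f$, and the two rays of a two dimensional cone $\tau$ of $\xi(f)$ have representatives meeting in a unique arrow of the boundary of $f$, called the arrow corresponding to $\tau$. For a two dimensional cone $\sigma$ of $\Xi$ and $f\in Q_2$, let $\sigma_f$ be the unique two dimensional cone of $\xi(f)$ containing $\sigma$ and let $P_f(\sigma)\in\mathbb{Z}^{Q_1}$ be 1 on the arrow of $\partial f$ corresponding to $\sigma_f$ and 0 on all other arrows. Put $P(\sigma)=\tfrac12\sum_{f\in Q_2}P_f(\sigma)$; this is a perfect matching. *)

(* Defs.v *)
From HB Require Import structures.
From mathcomp Require Import all_boot all_order all_fingroup all_algebra.
From mathcomp Require Import boolp classical_sets reals.

Set Implicit Arguments.
Unset Strict Implicit.
Unset Printing Implicit Defensive.

Import Order.TTheory GRing.Theory Num.Theory.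

Local Open Scope quotient_scope.
Local Open Scope classical_set_scope.
Local Open Scope ring_scope.

Section QuotientModule.
Variables (K : nzRingType) (V : lmodType K) (W : submodClosed V).

Definition qpred : {pred V} := W.

Fact qpred_zmod : zmod_closed qpred.
Proof.
split=> [|x y Wx Wy]; first exact: (rpred0 W).
rewrite -scaleN1r; apply: (rpredD (S := W)) => //; exact: (@rpredZ _ _ W _ _ Wy).
Qed.

HB.instance Definition _ := GRing.isZmodClosed.Build V qpred qpred_zmod.

Definition qmod : Type := Quotient.quot qpred.
HB.instance Definition _ := GRing.Zmodule.on qmod.
HB.instance Definition _ := Quotient.on qmod.

Definition qclass (x : V) : qmod := \pi_(Quotient.quot qpred) x.

Lemma qclass_eq x y : (qclass x = qclass y) <-> (x - y \in W).
Proof.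
rewrite -[x - y \in W]/(x - y \in qpred) (Quotient.idealrBE qpred).
by split=> [/eqP|/eqP].
Qed.

Lemma qclassD x y : qclass (x + y) = qclass x + qclass y.
Proof. exact: (raddfD (\pi_(Quotient.quot qpred))). Qed.

Lemma qclass_surj (g : qmod) : exists x, g = qclass x.
Proof. by exists (generic_quotient.repr (g : Quotient.quot qpred)); rewrite /qclass reprK. Qed.

Definition qscale (k : K) (g : qmod) : qmod :=
  qclass (k *: generic_quotient.repr (g : Quotient.quot qpred)).

Lemma qscale_class k x : qscale k (qclass x) = qclass (k *: x).
Proof.
apply/qclass_eq; rewrite -scalerBr rpredZ //.
by apply/qclass_eq; rewrite /qclass reprK.
Qed.

Fact qscaleA k l g : qscale k (qscale l g) = qscale (k * l) g.
Proof. by have [x ->] := qclass_surj g; rewrite !qscale_class scalerA. Qed.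

Fact qscale1 : left_id 1 qscale.
Proof.
by move=> g; have [x ->] := qclass_surj g; rewrite qscale_class scale1r.
Qed.

Fact qscaleDr : right_distributive qscale +%R.
Proof.
move=> k g h; have [x ->] := qclass_surj g; have [y ->] := qclass_surj h.
by rewrite -qclassD !qscale_class scalerDr qclassD.
Qed.

Fact qscaleDl g : {morph qscale^~ g : k l / k + l}.
Proof.
move=> k l; have [x ->] := qclass_surj g.
by rewrite !qscale_class scalerDl qclassD.
Qed.

HB.instance Definition _ := GRing.Zmodule_isLmodule.Build K qmod
  qscaleA qscale1 qscaleDr qscaleDl.

End QuotientModule.

Section Cones.
Variables (R : realType) (V : lmodType R).

Definition ray (u : V) : set V := [set x | exists2 t : R, 0 <= t & x = t *: u].

Definition cone (u v : V) : set V :=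
  [set x | exists s t : R, [/\ 0 <= s, 0 <= t & x = s *: u + t *: v]].

Definition lin_indep (u v : V) : Prop :=
  forall s t : R, s *: u + t *: v = 0 -> s = 0 /\ t = 0.

(* In a plane, the two dimensional cones of the complete fan whose rays are
   generated by S are the strictly convex sectors bounded by two neighbouring
   rays; u and v generate the two rays of tau. *)
Definition fan_cone (S : set V) (u v : V) (tau : set V) : Prop :=
  [/\ S u, S v, lin_indep u v, tau = cone u v
    & forall s, S s -> tau s -> ray u s \/ ray v s].

Definition two_dim_cone (S : set V) (tau : set V) : Prop :=
  exists u v, fan_cone S u v tau.

Definition convex_hull (S : set V) : set V :=
  [set x | exists (n : nat) (p : 'I_n -> V) (t : 'I_n -> R),
    [/\ forall i, S (p i), forall i, 0 <= t i, \sum_i t i = 1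
      & x = \sum_i t i *: p i]].

Definition is_vertex (P : set V) (x : V) : Prop :=
  P x /\ forall (y z : V) (t : R), P y -> P z -> 0 < t < 1 ->
    x = t *: y + (1 - t) *: z -> y = x /\ z = x.

End Cones.

(* A finite polygonal cell decomposition of an oriented closed connected
   surface is encoded by its combinatorial map.  An arrow of the quiver is an
   edge of the dimer model; [bnext a] (resp. [wnext a]) is the arrow following
   [a] in the oriented boundary of the black (resp. white) face containing [a].
   The black (white) dimer vertices are the cycles of [bnext] ([wnext]), and
   the length of a cycle is the valence of the vertex.  The arrows leaving a
   given quiver vertex, i.e. a tile, form a cycle of [bnext^-1 * wnext].  The
   surface is a torus when its Euler characteristic V - E + F is 0.
   Transitivity includes that there is at least one arrow. *)
Record dimer := Dimer {
  Q1 : finType;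
  bnext : {perm Q1};
  wnext : {perm Q1};
  bvalence : forall a, bnext a != a;
  wvalence : forall a, wnext a != a;
  dimer_connected :
    [transitive <<[set bnext; wnext]%SET>>, on [set: Q1]%SET | 'P]%g;
  dimer_torus :
    (#|porbits bnext| + #|porbits wnext| + #|porbits (bnext^-1 * wnext)%g|
      = #|Q1|)%N }.

(* Locked, as the comparison of elements of Q0 below should not be unfolded. *)
HB.lock Definition single (K : nzRingType) (I : finType) (i : I) :
    {ffun I -> K^o} :=
  [ffun j => (j == i)%:R].

Section Quiver.
Variable D : dimer.

Definition vrot : {perm Q1 D} := ((bnext D)^-1 * wnext D)%g.

Definition Q0 : finType := {v : {set Q1 D} | v \in porbits vrot}.

Definition arrow_tail (a : Q1 D) : Q0 :=
  exist _ (porbit vrot a) (imset_f (porbit vrot) (isT : a \in Q1 D)).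

Definition arrow_head (a : Q1 D) : Q0 := arrow_tail (bnext D a).

Lemma arrow_tail_wnext a : arrow_tail (wnext D a) = arrow_head a.
Proof.
apply/val_inj/eqP; rewrite /= eq_porbit_mem.
have -> : wnext D a = vrot (bnext D a) by rewrite permM permK.
by have := mem_porbit vrot 1 (bnext D a); rewrite expg1.
Qed.

(* Black faces, then white faces. *)
Definition Q2 : finType :=
  ({B : {set Q1 D} | B \in porbits (bnext D)}
   + {W : {set Q1 D} | W \in porbits (wnext D)})%type.

Definition boundary (f : Q2) : {set Q1 D} :=
  match f with inl B => val B | inr W => val W end.

Section Coefficients.
Variable K : nzRingType.

Local Notation C0 := {ffun Q0 -> K^o}.
Local Notation C1 := {ffun Q1 D -> K^o}.
Local Notation C2 := {ffun Q2 -> K^o}.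

(* The cellular chain complex; every face is oriented by its boundary cycle. *)
Definition bd1 (z : C1) : C0 :=
  [ffun v =>
    \sum_(a | arrow_head a == v) z a - \sum_(a | arrow_tail a == v) z a].
Definition bd2 (c : C2) : C1 := [ffun a => \sum_(f | a \in boundary f) c f].

Definition d0 (g : C0) : C1 :=
  [ffun a => g (arrow_head a) - g (arrow_tail a)].
Definition d1 (v : C1) : C2 := [ffun f => \sum_(a in boundary f) v a].

Definition boundaries : {pred C1} :=
  fun z => `[< exists c : C2, z = bd2 c >].
Definition coboundaries : {pred C1} :=
  fun z => `[< exists g : C0, z = d0 g >].

Fact boundaries_submod : submod_closed boundaries.
Proof.
split=> [|k x y /asboolP[c ->] /asboolP[e ->]]; apply/asboolP.
  by exists 0; apply/ffunP => a; rewrite !ffunE big1 // => f _; rewrite ffunE.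
exists (k *: c + e); apply/ffunP => a; rewrite !ffunE scaler_sumr -big_split.
by apply: eq_bigr => f _; rewrite !ffunE.
Qed.

Fact coboundaries_submod : submod_closed coboundaries.
Proof.
split=> [|k x y /asboolP[c ->] /asboolP[e ->]]; apply/asboolP.
  by exists 0; apply/ffunP => a; rewrite !ffunE subrr.
exists (k *: c + e); apply/ffunP => a; rewrite !ffunE scalerBr opprD.
by rewrite addrACA.
Qed.

HB.instance Definition _ :=
  GRing.isSubmodClosed.Build K _ boundaries boundaries_submod.
HB.instance Definition _ :=
  GRing.isSubmodClosed.Build K _ coboundaries coboundaries_submod.

Definition C1B : Type := qmod boundaries.
HB.instance Definition _ := GRing.Lmodule.on C1B.

Definition chain_class (z : C1) : C1B := qclass boundaries z.

Definition arrow_class (a : Q1 D) : C1B := chain_class (single K a).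

(* H_1(T; K) = cycles / boundaries, as a submodule of chains / boundaries; for
   a field K of characteristic zero this is H_1(Q) tensored with K. *)
Definition H1 : set C1B := [set chain_class z | z in [set z | bd1 z = 0]].

(* Functions on Q1 modulo the image of d0.  For K = int this group is torsion
   free and contains N_o, where the classes of the perfect matchings lie; so
   for K = R it contains N_o tensored with R. *)
Definition C1d : Type := qmod coboundaries.
HB.instance Definition _ := GRing.Lmodule.on C1d.

Definition cochain_class (v : C1) : C1d := qclass coboundaries v.

End Coefficients.

Arguments H1 K _ : clear implicits.

(* As the fundamental group of a torus is abelian, walks starting at a base
   vertex o are homotopic iff they have the same end point and homologous
   chains.  So a vertex of the universal cover is a pair
   (v, g) where g is the class of a chain with boundary v - o, and an arrow is
   a pair (a, g) whose tail is (arrow_tail a, g). *)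
Definition Q0t : Type := (Q0 * C1B int)%type.
Definition Q1t : Type := (Q1 D * C1B int)%type.

Definition cover_tail (x : Q1t) : Q0t := (arrow_tail x.1, x.2).
Definition cover_head (x : Q1t) : Q0t :=
  (arrow_head x.1, x.2 + arrow_class int x.1).

Definition cover_vertex (o : Q0) : set Q0t :=
  [set y | exists2 z : {ffun Q1 D -> int^o},
     bd1 z = single int y.1 - single int o & y.2 = chain_class z].

Definition cover_arrow (o : Q0) : set Q1t :=
  [set x | cover_vertex o (cover_tail x)].

Definition tbnext (x : Q1t) : Q1t :=
  (bnext D x.1, x.2 + arrow_class int x.1).
Definition twnext (x : Q1t) : Q1t :=
  (wnext D x.1, x.2 + arrow_class int x.1).

(* The boundary of the black (white) face of the universal cover through x. *)
Definition bface (x : Q1t) : set Q1t := [set y | exists k, y = iter k tbnext x].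
Definition wface (x : Q1t) : set Q1t := [set y | exists k, y = iter k twnext x].

(* The action of H_1(Q) on the universal cover by deck transformations. *)
Definition translate (h : C1B int) (x : Q1t) : Q1t := (x.1, x.2 + h).

Section Rhombic.
Variables (R : realType) (o : Q0).

Definition sqlen (u : 'rV[R]_2) : R := \sum_i u 0 i ^+ 2.

Definition det2 (u v : 'rV[R]_2) : R := u 0 0 * v 0 1 - u 0 1 * v 0 0.

Definition open_segment (p q : 'rV[R]_2) : set 'rV[R]_2 :=
  [set x | exists2 t : R, 0 < t < 1 & x = (1 - t) *: p + t *: q].

Definition open_parallelogram (p u v : 'rV[R]_2) : set 'rV[R]_2 :=
  [set x | exists s t : R, [/\ 0 < s < 1, 0 < t < 1 & x = p + s *: u + t *: v]].

(* The cells of the quad graph lifted to the universal cover.  Its edges are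
   the corners of the quiver faces: [BEdge x] and [WEdge x] join the tail of x
   to the black and the white face through x.  Its faces correspond to the
   arrows: going anticlockwise, the corners of [Quad x] are the tail of x, the
   white face on its right, its head, and the black face on its left. *)
Inductive quad_cell :=
  | QVertex of Q0t
  | BVertex of set Q1t
  | WVertex of set Q1t
  | BEdge of Q1t
  | WEdge of Q1t
  | Quad of Q1t.

Definition is_quad_cell (c : quad_cell) : Prop :=
  match c with
  | QVertex y => cover_vertex o y
  | BVertex F => exists2 x, cover_arrow o x & F = bface x
  | WVertex F => exists2 x, cover_arrow o x & F = wface x
  | BEdge x | WEdge x | Quad x => cover_arrow o x
  end.

Section Image.
Variables (pV : Q0t -> 'rV[R]_2) (pB pW : set Q1t -> 'rV[R]_2).

Definition cell_image (c : quad_cell) : set 'rV[R]_2 :=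
  match c with
  | QVertex y => [set pV y]
  | BVertex F => [set pB F]
  | WVertex F => [set pW F]
  | BEdge x => open_segment (pV (cover_tail x)) (pB (bface x))
  | WEdge x => open_segment (pV (cover_tail x)) (pW (wface x))
  | Quad x => open_parallelogram (pV (cover_tail x))
      (pW (wface x) - pV (cover_tail x)) (pB (bface x) - pV (cover_tail x))
  end.

Definition rhombic_embedding : Prop :=
  [/\ exists rho : C1B int -> 'rV[R]_2, forall h x, H1 int h ->
        cover_arrow o x ->
        [/\ pV (cover_tail (translate h x)) = pV (cover_tail x) + rho h,
            pB (bface (translate h x)) = pB (bface x) + rho h
          & pW (wface (translate h x)) = pW (wface x) + rho h],
      exists2 l : R, 0 < l & forall x, cover_arrow o x ->
        sqlen (pB (bface x) - pV (cover_tail x)) = l ^+ 2 /\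
        sqlen (pW (wface x) - pV (cover_tail x)) = l ^+ 2,
      forall x, cover_arrow o x ->
        pV (cover_head x) - pW (wface x) = pB (bface x) - pV (cover_tail x) /\
        0 < det2 (pW (wface x) - pV (cover_tail x))
                 (pB (bface x) - pV (cover_tail x))
    & forall p : 'rV[R]_2,
        exists! c : quad_cell, is_quad_cell c /\ cell_image c p].

End Image.

(* A rhombic embedding in the flat torus R^2 / rho(H_1(Q)), lifted to the
   universal covers: it is equivariant, the edges have the same length, the
   faces are rhombi, and the plane is the disjoint union of the (open) cells. *)
Definition geometrically_consistent : Prop :=
  exists (pV : Q0t -> 'rV[R]_2) (pB pW : set Q1t -> 'rV[R]_2),
    rhombic_embedding pV pB pW.

End Rhombic.

Section ZigZag.
Variable o : Q0.

Definition zigzag_flow (eta : int -> Q1t) : Prop :=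
  [/\ forall n, cover_arrow o (eta n),
      forall n, cover_head (eta n) = cover_tail (eta (n + 1)),
      forall n, bface (eta (2 * n)) (eta (2 * n + 1))
    & forall n, wface (eta (2 * n - 1)) (eta (2 * n))].

Definition is_period (eta : int -> Q1t) (k : nat) : Prop :=
  (0 < k)%N /\ forall n, (eta (n + k%:Z)).1 = (eta n).1.

(* The length of a single period of the projected zig-zag path. *)
Definition zz_period (eta : int -> Q1t) : nat :=
  xget 0%N [set k | is_period eta k /\
                    forall j, is_period eta j -> (k <= j)%N].

Definition zz_class (K : nzRingType) (eta : int -> Q1t) : C1B K :=
  \sum_(i < zz_period eta) arrow_class K (eta i%:Z).1.

Definition primitive (c : C1B int) : Prop :=
  H1 int c /\ forall (m : nat) c', H1 int c' -> c = c' *+ m -> m = 1%N.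

Section Fans.
Variable R : realType.

Definition represents (eta : int -> Q1t) (gamma : set (C1B R)) : Prop :=
  [/\ zigzag_flow eta, primitive (zz_class int eta)
    & gamma = ray (zz_class R eta)].

(* The generators of the rays of the local and global zig-zag fans. *)
Definition local_fan (f : Q2) : set (C1B R) :=
  [set zz_class R eta | eta in
    [set eta | zigzag_flow eta /\ exists n, (eta n).1 \in boundary f]].

Definition global_fan : set (C1B R) :=
  [set zz_class R eta | eta in zigzag_flow].

(* The flows representing the two rays of tau meet in an arrow x of the
   universal cover lying over a. *)
Definition corresponds (f : Q2) (tau : set (C1B R)) (a : Q1 D) : Prop :=
  a \in boundary f /\
  exists u v, fan_cone (local_fan f) u v tau /\
  exists x eta1 eta2,
    [/\ x.1 = a, represents eta1 (ray u), represents eta2 (ray v),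
        exists n, eta1 n = x & exists n, eta2 n = x].

Definition matching_at (f : Q2) (sigma : set (C1B R)) (a : Q1 D) : rat :=
  `[< exists tau, [/\ two_dim_cone (local_fan f) tau, sigma `<=` tau
                    & corresponds f tau a] >]%:R.

Definition matching_of_cone (sigma : set (C1B R)) : {ffun Q1 D -> rat} :=
  [ffun a => 2^-1 * \sum_(f : Q2) matching_at f sigma a].

End Fans.
End ZigZag.

Section Matchings.
Variable R : realType.

Definition matching_val (K : nzRingType) (m : {ffun Q1 D -> nat}) :
    {ffun Q1 D -> K^o} :=
  [ffun a => (m a)%:R].

Definition perfect_matching (m : {ffun Q1 D -> nat}) : Prop :=
  d1 (matching_val int m) = [ffun=> 1].

Definition matching_point (m : {ffun Q1 D -> nat}) : C1d R :=
  cochain_class (matching_val R m).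

Definition matching_polygon : set (C1d R) :=
  convex_hull [set matching_point m | m in perfect_matching].

Definition extremal (m : {ffun Q1 D -> nat}) : Prop :=
  perfect_matching m /\ is_vertex matching_polygon (matching_point m).

End Matchings.

End Quiver.

Arguments H1 D K _ : clear implicits.
Arguments local_fan {D} o R f _.
Arguments global_fan {D} o R _.
Arguments matching_polygon {D} R _.

(* Main.v *)
(* The even arrows of a zigzag path form an orbit of [zz_next], and
   each arrow [x] lies on two of them, the orbits of [x] and of [bprev x].  In the
   rhombic embedding the rhombi of a zigzag path share a common side [w], which
   fixes the sign of all its crossings with another path: the intersection number
   counts crossings without cancellation.  As H_1 is a plane, the classes of the
   zigzag paths meeting a face then turn once around it, in the order of the
   directions [w]; this identifies P(sigma) with the arrows [x] such that sigma
   lies between the classes of [bprev x] and [x].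
   A perfect matching takes at most half of the arrows of a zigzag path, and
   P(sigma) attains this bound on the two paths c, d spanning sigma, so that its
   class is a vertex.  Conversely a vertex is exposed by a functional, i.e. by a
   class of H_1, which lies in some sigma.  That P(sigma) is the only matching of
   its class follows by comparing degrees along the zigzag paths one after the
   other, moving clockwise away from sigma. *)

From HB Require Import structures.
From mathcomp Require Import all_boot all_order all_fingroup all_algebra.
From mathcomp Require Import zify ring lra.
From mathcomp Require Import boolp classical_sets reals.
Require Import Defs.

Set Implicit Arguments.
Unset Strict Implicit.
Unset Printing Implicit Defensive.

Import Order.TTheory GRing.Theory Num.Theory.

Local Open Scope classical_set_scope.
Local Open Scope ring_scope.

(** * Chains and cochains *)

Section Chains.
Variable D : dimer.
Implicit Types a x : Q1 D.

(** The embedding and homology are linked by a one-way implication: a positive intersection number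
    forces the sides [w] to turn positively, while an intersection number 0 leaves the sign for [w]
    open. Hence [turning], which speaks of signs of determinants only, is first proved for [w] from
    the disjointness of the rhombi and then transferred to the classes; the cyclic order at a face
    is derived from [turning] alone. The group H_1 is never computed. Euler's formula bounds its
    rank by 2, and the intersection numbers with the two zigzag paths through one arrow [a0], which
    do cross, serve as coordinates. In these the determinant of two classes is a positive multiple
    of their intersection number. Uniqueness of the matching has to be proved because extremality is
    a property of the class in [C1d], which several matchings might share. Primitivity of the zigzag
    classes enters because the arrow corresponding to a cone is defined through representatives of
    rays. *)

Lemma dimer_ind (P : Q1 D -> Prop) a0 :
  P a0 -> (forall a, P a -> P (bnext D a)) -> (forall a, P a -> P (wnext D a)) ->
  forall a, P a.
Proof.
move=> P0 Pb Pw a.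
pose S := [set x | `[< P x >]]%SET.
have acts : (<<[set bnext D; wnext D]%SET>> \subset 'N(S | 'P))%g.
  rewrite gen_subG; apply/fintype.subsetP => s /finset.set2P sE.
  apply/astabsP => x; rewrite /= apermE.
  have Ss y : y \in S -> s y \in S.
    rewrite !inE => Py.
    by case: sE => ->; [apply: Pb | apply: Pw].
  apply/idP/idP; last exact: Ss.
  move=> sx; have : x \in s @^-1: S by rewrite finset.in_set.
  (* [S] lies in its preimage, and [s] injects the preimage into [S]; so closure under [s] is
     already invariance. *)
  have /eqP -> // : s @^-1: S == S.
  rewrite eq_sym eqEcard; apply/andP; split.
    by apply/fintype.subsetP => y /Ss Sy; rewrite finset.in_set.
  rewrite -(card_imset _ (@perm_inj _ s)) subset_leq_card //.
  by apply/fintype.subsetP => _ /imsetP[z + ->]; rewrite finset.in_set.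
have orbE := atransP (dimer_connected D) a0 (finset.in_setT a0).
have : a \in orbit 'P <<[set bnext D; wnext D]%SET>>%g a0 by rewrite orbE finset.in_setT.
case/imsetP => s /(fintype.subsetP acts) /astabsP sS ->.
have := sS a0; rewrite !inE /= => sE.
by apply: asboolW; rewrite sE; apply: asboolT.
Qed.

Lemma Q0_surj (v : Q0 D) : exists a, v = arrow_tail a.
Proof.
case: v => v vP; have /imsetP[a _ ve] := vP.
by exists a; apply/val_inj.
Qed.

Section Ring.
Variable K : comNzRingType.
Local Notation C0 := {ffun Q0 D -> K^o}.
Local Notation C1 := {ffun Q1 D -> K^o}.
Local Notation C2 := {ffun Q2 D -> K^o}.

Definition pairing (v z : C1) : K := \sum_a (v a : K) * z a.

Lemma singleE (I : finType) (i j : I) : (single K i) j = (j == i)%:R.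
Proof. by rewrite single.unlock ffunE. Qed.

Lemma pairingDl u v z : pairing (u + v) z = pairing u z + pairing v z.
Proof. by rewrite -big_split; apply: eq_bigr => a _; rewrite ffunE mulrDl. Qed.

Lemma pairingDr u v z : pairing z (u + v) = pairing z u + pairing z v.
Proof. by rewrite -big_split; apply: eq_bigr => a _; rewrite ffunE mulrDr. Qed.

Lemma pairingZl k v z : pairing (k *: v) z = k * pairing v z.
Proof.
by rewrite big_distrr; apply: eq_bigr => a _; rewrite ffunE -mulrA.
Qed.

Lemma pairingZr k v z : pairing z (k *: v) = k * pairing z v.
Proof.
by rewrite big_distrr; apply: eq_bigr => a _; rewrite ffunE mulrCA.
Qed.

Lemma pairingNl v z : pairing (- v) z = - pairing v z.
Proof. by rewrite -scaleN1r pairingZl mulN1r. Qed.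

Lemma pairingNr v z : pairing z (- v) = - pairing z v.
Proof. by rewrite -scaleN1r pairingZr mulN1r. Qed.

Lemma pairing0l z : pairing 0 z = 0.
Proof. by rewrite -(scale0r 0) pairingZl mul0r. Qed.

Lemma pairing0r z : pairing z 0 = 0.
Proof. by rewrite -(scale0r 0) pairingZr mul0r. Qed.

Lemma pairing_singler v a : pairing v (single K a) = v a.
Proof.
rewrite /pairing (bigD1 a) //= singleE eqxx mulr1 big1 ?addr0 // => x /negPf xa.
by rewrite singleE xa mulr0.
Qed.

Lemma pairing_singlel v a : pairing (single K a) v = v a.
Proof.
rewrite /pairing (bigD1 a) //= singleE eqxx mul1r big1 ?addr0 // => x /negPf xa.
by rewrite singleE xa mul0r.
Qed.

Lemma bd1_linear : linear (@bd1 D K).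
Proof.
move=> k x y; apply/ffunP => v; rewrite !ffunE.
rewrite scalerBr !scaler_sumr addrACA -opprD -!big_split /=.
by congr (_ - _); apply: eq_bigr => a _; rewrite !ffunE.
Qed.
HB.instance Definition _ := GRing.isLinear.Build K C1 C0 _ (@bd1 D K) bd1_linear.

Lemma bd2_linear : linear (@bd2 D K).
Proof.
move=> k x y; apply/ffunP => a; rewrite !ffunE scaler_sumr -big_split /=.
by apply: eq_bigr => f _; rewrite !ffunE.
Qed.
HB.instance Definition _ := GRing.isLinear.Build K C2 C1 _ (@bd2 D K) bd2_linear.

Lemma d1_linear : linear (@d1 D K).
Proof.
move=> k x y; apply/ffunP => a; rewrite !ffunE scaler_sumr -big_split /=.
by apply: eq_bigr => f _; rewrite !ffunE.
Qed.
HB.instance Definition _ := GRing.isLinear.Build K C1 C2 _ (@d1 D K) d1_linear.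

Lemma chain_class_linear : linear (@chain_class D K).
Proof. by move=> k x y; rewrite /chain_class qclassD -qscale_class. Qed.
HB.instance Definition _ :=
  GRing.isLinear.Build K C1 (C1B D K) _ (@chain_class D K) chain_class_linear.

Lemma cochain_class_linear : linear (@cochain_class D K).
Proof. by move=> k x y; rewrite /cochain_class qclassD -qscale_class. Qed.
HB.instance Definition _ :=
  GRing.isLinear.Build K C1 (C1d D K) _ (@cochain_class D K) cochain_class_linear.

Lemma chain_classD (x y : C1) : chain_class (x + y) = chain_class x + chain_class y.
Proof. exact: qclassD. Qed.

Lemma chain_classZ k (x : C1) : chain_class (k *: x) = k *: chain_class x.
Proof. exact/esym/qscale_class. Qed.

Lemma chain_class0 : chain_class 0 = 0 :> C1B D K.
Proof. exact: linear0. Qed.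

Lemma cochain_classD (x y : C1) :
  cochain_class (x + y) = cochain_class x + cochain_class y.
Proof. exact: qclassD. Qed.

Lemma cochain_classZ k (x : C1) : cochain_class (k *: x) = k *: cochain_class x.
Proof. exact/esym/qscale_class. Qed.

Lemma chain_classP (z z' : C1) :
  chain_class z = chain_class z' <-> exists c, z - z' = bd2 c.
Proof.
split; first by move/qclass_eq => /asboolP.
by move=> h; apply/qclass_eq/asboolP.
Qed.

Lemma cochain_classP (z z' : C1) :
  cochain_class z = cochain_class z' <-> exists g, z - z' = d0 g.
Proof.
split; first by move/qclass_eq => /asboolP.
by move=> h; apply/qclass_eq/asboolP.
Qed.

Lemma bd1_single a : bd1 (single K a) = single K (arrow_head a) - single K (arrow_tail a).
Proof.
apply/ffunP => v; rewrite !ffunE !singleE.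
have sumE (h : Q1 D -> Q0 D) :
    \sum_(x | h x == v) (single K a x : K^o) = (v == h a)%:R.
  rewrite big_mkcond (bigD1 a) //= singleE eqxx big1 ?addr0 => [|x /negPf xa].
    by rewrite eq_sym; case: eqP.
  by rewrite singleE xa; case: ifP.
by rewrite !sumE.
Qed.

Lemma pairing_d0 (g : C0) z : pairing (d0 g) z = \sum_v (g v : K) * bd1 z v.
Proof.
have sumE (h : Q1 D -> Q0 D) :
    \sum_a (g (h a) : K) * z a = \sum_v (g v : K) * \sum_(a | h a == v) z a.
  rewrite (partition_big h xpredT) //=; apply: eq_bigr => v _.
  by rewrite big_distrr; apply: eq_bigr => a /eqP <-.
rewrite /pairing; under eq_bigr do rewrite ffunE mulrBl.
rewrite sumrB !sumE -sumrB; apply: eq_bigr => v _.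
by rewrite ffunE mulrBr.
Qed.

Lemma pairing_bd2 v (c : C2) : pairing v (bd2 c) = \sum_f (d1 v f : K) * c f.
Proof.
rewrite /pairing; under eq_bigr do rewrite ffunE big_distrr big_mkcond.
rewrite exchange_big /=; apply: eq_bigr => f _.
by rewrite ffunE big_distrl -big_mkcond.
Qed.

Lemma pairing_chain_class v z z' :
  d1 v = 0 -> chain_class z = chain_class z' -> pairing v z = pairing v z'.
Proof.
move=> dv /chain_classP[c zE]; apply/eqP; rewrite -subr_eq0 -pairingNr -pairingDr.
rewrite zE pairing_bd2 dv big1 // => f _; by rewrite ffunE mul0r.
Qed.

Lemma pairing_cochain_class v v' z :
  bd1 z = 0 -> cochain_class v = cochain_class v' -> pairing v z = pairing v' z.
Proof.
move=> dz /cochain_classP[g vE]; apply/eqP; rewrite -subr_eq0 -pairingNl -pairingDl.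
rewrite vE pairing_d0 dz big1 // => f _; by rewrite ffunE mulr0.
Qed.

Lemma connected_chain (u v : Q0 D) :
  exists z, bd1 z = single K v - single K u.
Proof.
have [a ->] := Q0_surj u; have [a' ->] := Q0_surj v.
pose P x := exists z, bd1 z = single K (arrow_tail x) - single K (arrow_tail a).
have step x : P x -> exists z, bd1 z = single K (arrow_head x) - single K (arrow_tail a).
  move=> [z zE]; exists (z + single K x).
  by rewrite linearD /= zE bd1_single addrC addrA subrK.
apply: (@dimer_ind P a) => [|x|x].
- by exists 0; rewrite linear0 subrr.
- exact: step.
- by rewrite /P arrow_tail_wnext; exact: step.
Qed.

(** The potential at [u] is the value of [v] on a path from a base vertex to [u]; it is independent
    of the path because [v] vanishes on cycles. *)
Lemma coboundary_of_pairing v :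
  (forall z, bd1 z = 0 -> pairing v z = 0) -> exists g, v = d0 g.
Proof.
have a0 : {a : Q1 D | True}.
  have /card_gt0P : (0 < #|[set: Q1 D]%SET|)%N.
    have := imsetP (dimer_connected D) => -[a _ _].
    by apply/card_gt0P; exists a.
  by move=> h; apply: cid; case: h => a _; exists a.
case: a0 => a0 _ v0.
pose zz u := projT1 (cid (connected_chain (arrow_tail a0) u)).
have zzE u : bd1 (zz u) = single K u - single K (arrow_tail a0).
  by rewrite /zz; case: cid.
exists [ffun u => pairing v (zz u)]; apply/ffunP => a; rewrite !ffunE.
have := v0 (zz (arrow_tail a) + single K a - zz (arrow_head a)).
rewrite linearB linearD /= !zzE bd1_single => /(_ _) zE.
have {zE} : pairing v (zz (arrow_tail a) + single K a - zz (arrow_head a)) = 0.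
  by apply: zE; rewrite [X in X - _]addrC addrA subrK subrr.
rewrite pairingDr pairingDr pairingNr pairing_singler => /eqP.
by rewrite subr_eq add0r addrC => /eqP <-; rewrite addrK.
Qed.

End Ring.
End Chains.
(** * Zigzag paths as cycles and cocycles *)

Section ZigZagChains.
Variable D : dimer.
Implicit Types (a x y : Q1 D) (f : Q2 D).

Definition zz_next : {perm Q1 D} := (bnext D * wnext D)%g.
Definition bprev : {perm Q1 D} := (bnext D)^-1%g.
(* White faces are traversed backwards, so that for both colours [prev f x] lies
   on the zigzag path of which [x] is an odd arrow. *)
Definition prev f : {perm Q1 D} := if f is inl _ then bprev else wnext D.
(* A zigzag path is encoded by its even arrows; the odd ones are the [x] with
   [bprev x] in the orbit. *)
Definition zz a : {set Q1 D} := porbit zz_next a.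

Lemma zz_nextE x : zz_next x = wnext D (bnext D x).
Proof. by rewrite permM. Qed.

Lemma bprevK x : bprev (bnext D x) = x.
Proof. by rewrite permK. Qed.

Lemma bnext_bprev x : bnext D (bprev x) = x.
Proof. by rewrite permKV. Qed.

Lemma zz_next_bprev x : zz_next (bprev x) = wnext D x.
Proof. by rewrite zz_nextE bnext_bprev. Qed.

Lemma zz_next_in a x : (zz_next x \in zz a) = (x \in zz a).
Proof.
rewrite /zz -!eq_porbit_mem [porbit zz_next (zz_next x) == _]eq_sym [porbit zz_next x == _]eq_sym.
have -> // : porbit zz_next (zz_next x) = porbit zz_next x.
by apply/eqP; rewrite eq_porbit_mem; have := mem_porbit zz_next 1 x; rewrite expg1.
Qed.

Lemma zz_refl a : a \in zz a. Proof. exact: porbit_id. Qed.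

Lemma zz_eq a x : x \in zz a -> zz x = zz a.
Proof. by rewrite /zz -eq_porbit_mem => /eqP. Qed.

Lemma zz_ind a (P : Q1 D -> Prop) :
  P a -> (forall x, x \in zz a -> P x -> P (zz_next x)) -> forall x, x \in zz a -> P x.
Proof.
move=> Pa PZ x /porbitP[i ->]; elim: i => [|i IH]; first by rewrite expg0 perm1.
by rewrite expgSr permM; apply: PZ => //; exact: mem_porbit.
Qed.

Lemma zz_fun (T : Type) (g : Q1 D -> T) a x :
  (forall x, g (zz_next x) = g x) -> x \in zz a -> g x = g a.
Proof. by move=> gZ; apply: (zz_ind (P := fun x => g x = g a)) => // y _ <-. Qed.

Lemma zz_wnext a x : (wnext D x \in zz a) = (bprev x \in zz a).
Proof. by rewrite -zz_next_bprev zz_next_in. Qed.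

Lemma zz_prev f a x : (prev f x \in zz a) = (bprev x \in zz a).
Proof. by case: f => ? //=; rewrite zz_wnext. Qed.

Lemma prev_fun (T : Type) (g : Q1 D -> T) f x :
  (forall x, g (zz_next x) = g x) -> g (prev f x) = g (bprev x).
Proof. by case: f => ? gZ //=; rewrite -zz_next_bprev gZ. Qed.

Lemma boundaryE f a : a \in boundary f -> boundary f = porbit (prev f) a.
Proof.
case: f => -[B BP] /= aB; have /imsetP[x _ Bx] := BP; rewrite Bx in aB *.
  by rewrite /bprev porbitV; apply/eqP; rewrite eq_sym eq_porbit_mem.
by apply/eqP; rewrite eq_sym eq_porbit_mem.
Qed.

Lemma boundary_prev f a : (prev f a \in boundary f) = (a \in boundary f).
Proof.
have step x : x \in boundary f -> prev f x \in boundary f.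
  move=> xf; rewrite (boundaryE xf); have := mem_porbit (prev f) 1 x.
  by rewrite expg1.
apply/idP/idP; last exact: step.
move=> pf; rewrite (boundaryE pf) porbit_sym.
by have := mem_porbit (prev f) 1 a; rewrite expg1.
Qed.

Lemma prev_neq f a : prev f a != a.
Proof.
case: f => ? /=; last exact: wvalence.
by apply/eqP => e; have /eqP := bvalence a; apply; rewrite -{1}e bnext_bprev.
Qed.

Definition bface_of a : Q2 D :=
  inl (exist _ (porbit (bnext D) a) (imset_f (porbit (bnext D)) (isT : a \in Q1 D))).
Definition wface_of a : Q2 D :=
  inr (exist _ (porbit (wnext D) a) (imset_f (porbit (wnext D)) (isT : a \in Q1 D))).

Lemma bface_ofP a : a \in boundary (bface_of a). Proof. exact: porbit_id. Qed.
Lemma wface_ofP a : a \in boundary (wface_of a). Proof. exact: porbit_id. Qed.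

Lemma bface_of_bnext a : bface_of (bnext D a) = bface_of a.
Proof.
congr inl; apply/val_inj/eqP; rewrite /= eq_porbit_mem.
by have := mem_porbit (bnext D) 1 a; rewrite expg1.
Qed.

Lemma wface_of_wnext a : wface_of (wnext D a) = wface_of a.
Proof.
congr inr; apply/val_inj/eqP; rewrite /= eq_porbit_mem.
by have := mem_porbit (wnext D) 1 a; rewrite expg1.
Qed.

Lemma sum_faces (V : nmodType) (F : Q2 D -> V) a :
  \sum_(f | a \in boundary f) F f = F (bface_of a) + F (wface_of a).
Proof.
rewrite big_sumType /=; congr (_ + _).
  rewrite (big_pred1 (exist _ (porbit (bnext D) a)
    (imset_f (porbit (bnext D)) (isT : a \in Q1 D)))) // => -[B BP] /=.
  rewrite -val_eqE /=; have /imsetP[x _ ->] := BP.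
  by rewrite eq_sym eq_porbit_mem.
rewrite (big_pred1 (exist _ (porbit (wnext D) a)
  (imset_f (porbit (wnext D)) (isT : a \in Q1 D)))) // => -[B BP] /=.
rewrite -val_eqE /=; have /imsetP[x _ ->] := BP.
by rewrite eq_sym eq_porbit_mem.
Qed.

Section Ring.
Variable K : comNzRingType.

Definition zz_chain a : {ffun Q1 D -> K^o} :=
  [ffun x => (x \in zz a)%:R + (bprev x \in zz a)%:R].
(** The strand through the midpoints of the arrows of a zigzag path crosses even and odd arrows in
    opposite senses; this cochain counts the signed crossings of a chain with that strand. *)
Definition zz_cocycle a : {ffun Q1 D -> K^o} :=
  [ffun x => (bprev x \in zz a)%:R - (x \in zz a)%:R].

Lemma zz_chain_eq a x : x \in zz a -> zz_chain x = zz_chain a.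
Proof. by move=> /zz_eq xa; apply/ffunP => y; rewrite !ffunE xa. Qed.

Lemma sum_zz (F : Q1 D -> K) a :
  \sum_x F x * (bprev x \in zz a)%:R = \sum_x F (bnext D x) * (x \in zz a)%:R.
Proof.
rewrite (reindex_inj (@perm_inj _ (bnext D))) /=.
by apply: eq_bigr => x _; rewrite bprevK.
Qed.

Lemma pairing_zz_chain v a :
  pairing v (zz_chain a) = \sum_(x in zz a) ((v x : K) + v (bnext D x)).
Proof.
rewrite /pairing; under eq_bigr do rewrite ffunE mulrDr.
rewrite big_split /= sum_zz -big_split [RHS]big_mkcond /=.
by apply: eq_bigr => x _; case: ifP; rewrite ?mulr1 ?mulr0 ?addr0.
Qed.

Lemma zz_chainE a : zz_chain a = \sum_(y in zz a) (single K y + single K (bnext D y)).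
Proof.
apply/ffunP => x.
by rewrite -[LHS]pairing_singlel pairing_zz_chain sum_ffunE; apply: eq_bigr => y _;
  rewrite !ffunE !singleE (eq_sym y) (eq_sym (bnext D y)).
Qed.

Lemma bd1_zz_chain a : bd1 (zz_chain a) = 0.
Proof.
rewrite zz_chainE linear_sum /=.
under eq_bigr => y _ do rewrite linearD /= !bd1_single addrC addrA subrK
  /arrow_head -/(arrow_head (bnext D y)) -arrow_tail_wnext -zz_nextE.
rewrite sumrB [X in _ - X](reindex_inj (@perm_inj _ zz_next)) /=.
by under [X in _ - X]eq_bigl => y do rewrite zz_next_in; rewrite subrr.
Qed.

(** Around a face the even and odd arrows of the path come in consecutive pairs, matched by
    [prev f], and have opposite signs. *)
Lemma d1_zz_cocycle a : d1 (zz_cocycle a) = 0.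
Proof.
apply/ffunP => f; rewrite !ffunE; under eq_bigr do rewrite ffunE.
rewrite sumrB; apply/eqP; rewrite subr_eq0; apply/eqP.
rewrite [RHS](reindex_inj (@perm_inj _ (prev f))) /=.
by apply: eq_big => [x|x _]; rewrite ?boundary_prev ?zz_prev.
Qed.

Definition ncross a a' : nat := #|[set x | (bprev x \in zz a) && (x \in zz a')]%SET|.

(** Arrows that have the same parity on both paths cancel: [bnext D] carries the common even ones
    onto the common odd ones. *)
Lemma pairing_cocycle_chain a a' :
  pairing (zz_cocycle a) (zz_chain a') = (ncross a a')%:R - (ncross a' a)%:R.
Proof.
rewrite /pairing; under eq_bigr do rewrite !ffunE mulrDr !mulrBl -!natrM.
rewrite big_split !sumrB /= addrACA -opprD.
have nE u u' : (ncross u u')%:R = \sum_x ((bprev x \in zz u) * (x \in zz u'))%:R :> K.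
  by rewrite /ncross -sum1_card -natr_sum big_mkcond; congr (_%:R); apply: eq_bigr => x _;
    rewrite finset.inE; case: (_ \in _); case: (_ \in _).
have <- : \sum_x ((bprev x \in zz a) * (bprev x \in zz a'))%:R
   = \sum_x ((x \in zz a) * (x \in zz a'))%:R :> K.
  rewrite (reindex_inj (@perm_inj _ (bnext D))) /=.
  by apply: eq_bigr => x _; rewrite bprevK.
rewrite opprD addrA addrK -nE; congr (_ - _); rewrite nE.
by apply: eq_bigr => x _; rewrite mulnC.
Qed.

Lemma pairing_cocycle_chainC a a' : pairing (zz_cocycle a) (zz_chain a') = - pairing (zz_cocycle a') (zz_chain a).
Proof. by rewrite !pairing_cocycle_chain opprB. Qed.

End Ring.
End ZigZagChains.
Arguments zz_next {D}.
Arguments bprev {D}.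

(** * Euler's formula and the rank of H_1 *)

Section Rank.
Variables (D : dimer) (K : fieldType).
Local Notation C0 := {ffun Q0 D -> K^o}.
Local Notation C1 := {ffun Q1 D -> K^o}.
Local Notation C2 := {ffun Q2 D -> K^o}.

Lemma dim_ffun (I : finType) : \dim {: {ffun I -> K^o} } = #|I|.
Proof. by rewrite dimvf /dim /= muln1. Qed.

Lemma card_Q0_Q2 : (#|Q0 D| + #|Q2 D| = #|Q1 D|)%N.
Proof.
by rewrite -(dimer_torus D) card_sum !card_sig addnC.
Qed.

Lemma d1_d0 (g : C0) : d1 (d0 g) = 0.
Proof.
apply/ffunP => f; rewrite !ffunE; under eq_bigr do rewrite ffunE.
rewrite sumrB; case: f => f.
  rewrite [X in X - _](reindex_inj (@perm_inj _ (prev (inl f)))) /=.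
  rewrite (eq_bigl _ _ (boundary_prev (inl f))) -sumrB big1 // => a _.
  by rewrite /arrow_head bnext_bprev subrr.
rewrite [X in _ - X](reindex_inj (@perm_inj _ (prev (inr f)))) /=.
rewrite (eq_bigl _ _ (boundary_prev (inr f))) -sumrB big1 // => a _.
by rewrite arrow_tail_wnext subrr.
Qed.

Lemma bd1_bd2 (c : C2) : bd1 (bd2 c) = 0.
Proof.
apply/ffunP => v; rewrite [RHS]ffunE.
have := pairing_d0 (single K v) (bd2 c); rewrite pairing_bd2 d1_d0.
rewrite big1 => [|f _]; last by rewrite ffunE mul0r.
rewrite (bigD1 v) //= singleE eqxx mul1r big1 ?addr0 // => u /negPf uv.
by rewrite singleE uv mul0r.
Qed.

(** Each arrow lies on one black and one white face, so a chain of faces with boundary 0 takes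
    opposite values on these two; connectedness spreads a zero to all faces. *)
Lemma bd2_eq0 (c : C2) f : bd2 c = 0 -> c f = 0 -> c = 0.
Proof.
move=> c0; pose P a := c (bface_of a) = 0.
have cE a : (c (bface_of a) : K) + c (wface_of a) = 0.
  by have /ffunP/(_ a) := c0; rewrite !ffunE sum_faces.
have bw a : P a <-> c (wface_of a) = 0.
  rewrite /P; split=> h; have /eqP := cE a; rewrite h; first by rewrite add0r => /eqP.
  by rewrite addr0 => /eqP.
have faceE (f' : Q2 D) : exists a, f' = bface_of a \/ f' = wface_of a.
  case: f' => -[B BP]; have /imsetP[a _ Ba] := BP; exists a; [left|right];
    by congr (_ _); apply/val_inj.
have [a0 a0E] := faceE f => cf0.
have Pa : forall a, P a.
  apply: (@dimer_ind D P a0) => [|a|a].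
  - by case: a0E cf0 => -> // h; apply/bw.
  - by rewrite /P bface_of_bnext.
  - by move=> /bw Pa; apply/bw; rewrite wface_of_wnext.
apply/ffunP => f'; rewrite ffunE; have [a [->|->]] := faceE f'; first exact: Pa.
by apply/bw.
Qed.

(** By connectedness the image of [bd1] together with one vertex spans all 0-chains. *)
Lemma dim_bd1_ker : (\dim (lker (linfun (@bd1 D K))) + #|Q0 D| <= #|Q1 D|.+1)%N.
Proof.
set f := linfun _; have := limg_ker_dim f fullv.
rewrite capfv dim_ffun => <-; rewrite -addnS leq_add2l -dim_ffun.
have [a0 _] : exists a0 : Q1 D, True.
  by have /imsetP[a0 _ _] := dimer_connected D; exists a0.
have full : (fullv <= limg f + <[single K (arrow_tail a0)]>)%VS.
  apply/subvP => g _.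
  have -> : g = \sum_v (g v : K) *: single K v.
    apply/ffunP => v; rewrite sum_ffunE (bigD1 v) //= !ffunE singleE eqxx.
    rewrite [_ *: _]mulr1 big1 ?addr0 // => u /negPf uv.
    by rewrite !ffunE singleE eq_sym uv [_ *: _]mulr0.
  apply: memv_suml => v _; apply: memvZ.
  have [z zE] := connected_chain K (arrow_tail a0) v.
  rewrite -(subrK (single K (arrow_tail a0)) (single K v)) -zE.
  by apply: memv_add; [rewrite -(lfunE (@bd1 D K)) memv_img // memvf | exact: memv_line].
apply: leq_trans (dimvS full) _; apply: leq_trans (dimv_add_leqif _ _) _.
by rewrite -addn1 leq_add2l dim_vline leq_b1.
Qed.

Lemma dim_bd2_img : (#|Q2 D| <= (\dim (limg (linfun (@bd2 D K)))).+1)%N.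
Proof.
set f := linfun _; have := limg_ker_dim f fullv.
rewrite capfv dim_ffun => <-; rewrite -add1n leq_add2r.
have [a0 _] : exists a0 : Q1 D, True.
  by have /imsetP[a0 _ _] := dimer_connected D; exists a0.
pose ev (c : C2) : K^o := c (bface_of a0).
have ev_lin : linear ev by move=> k x y; rewrite /ev !ffunE.
pose evL := GRing.isLinear.Build K C2 K^o _ ev ev_lin.
pose evl : {linear C2 -> K^o} := HB.pack ev evL.
have <- : \dim (linfun evl @: lker f) = \dim (lker f).
  apply: limg_dim_eq; apply/eqP; rewrite -subv0; apply/subvP => c.
  rewrite memv_cap !memv_ker !lfunE => /andP[/eqP c0 /eqP e0].
  by rewrite (bd2_eq0 c0 e0) mem0v.
by apply: leq_trans (dimvS (subvf _)) _; rewrite dimvf.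
Qed.

(* Euler's formula bounds the rank of H_1 by 2. *)
Lemma boundary_of_pairing v1 v2 z1 z2 (z : C1) :
    d1 v1 = 0 -> d1 v2 = 0 -> bd1 z1 = 0 -> bd1 z2 = 0 ->
    pairing v1 z1 * pairing v2 z2 - pairing v1 z2 * pairing v2 z1 != 0 ->
  bd1 z = 0 -> pairing v1 z = 0 -> pairing v2 z = 0 -> exists c, z = bd2 c.
Proof.
move=> dv1 dv2 dz1 dz2 det dz pz1 pz2.
pose phi (z : C1) : (K^o * K^o)%type := (pairing v1 z, pairing v2 z).
have phi_lin : linear phi by move=> k x y; rewrite /phi !pairingDr !pairingZr.
pose phiL := GRing.isLinear.Build K C1 (K^o * K^o)%type _ phi phi_lin.
pose phil : {linear C1 -> (K^o * K^o)%type} := HB.pack phi phiL.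
pose f1 := linfun (@bd1 D K); pose f2 := linfun (@bd2 D K).
pose g := linfun phil; pose U := lker f1.
have gU : (g @: U)%VS = fullv.
  apply/eqP; rewrite eqEsubv subvf /=; apply/subvP => -[x y] _.
  set d := _ - _ in det.
  pose s := (x * pairing v2 z2 - y * pairing v1 z2) / d.
  pose t := (y * pairing v1 z1 - x * pairing v2 z1) / d.
  have -> : (x, y) = g (s *: z1 + t *: z2).
    rewrite lfunE /= /phi !pairingDr !pairingZr.
    by congr (_, _); rewrite /s /t /d; field.
  apply: memv_img; rewrite memv_ker lfunE /= linearD !linearZ /= dz1 dz2.
  by rewrite !scaler0 addr0.
have sub : (limg f2 <= U :&: lker g)%VS.
  apply/subvP => _ /memv_imgP[c _ ->]; rewrite memv_cap !memv_ker !lfunE /=.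
  have -> : phi (bd2 c) = 0.
    by rewrite /phi !pairing_bd2 dv1 dv2 !big1 // => ? _; rewrite ffunE mul0r.
  by rewrite bd1_bd2 !eqxx.
(* The kernel of [bd1] exceeds the image of [bd2] by dimension 2 at most, and the surjection [g]
   onto a plane uses up both dimensions. *)
have dimE : \dim (limg f2) = \dim (U :&: lker g)%VS.
  apply/eqP; rewrite eqn_leq dimvS //=.
  have := limg_ker_dim g U; rewrite gU dimvf.
  have -> : dim (K^o * K^o)%type = 2%N by [].
  move=> dU.
  have := dim_bd1_ker; have := dim_bd2_img; have := card_Q0_Q2.
  rewrite -/f1 -/f2 -/U -dU; lia.
have : z \in (U :&: lker g)%VS.
  by rewrite memv_cap !memv_ker !lfunE /= dz /phi pz1 pz2 !eqxx.
have /eqP <- : limg f2 == (U :&: lker g)%VS by rewrite eqEdim sub dimE leqnn.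
by move=> /memv_imgP[c _ ->]; exists c; rewrite lfunE.
Qed.

End Rank.
(** * Determinants in the plane *)

Section Plane.
Variable R : realType.
Implicit Types p q u v : 'rV[R]_2.

Lemma det2C u v : det2 u v = - det2 v u.
Proof. by rewrite /det2; ring. Qed.

Lemma det2vv u : det2 u u = 0.
Proof. by rewrite /det2; ring. Qed.

Lemma det20l u : det2 0 u = 0.
Proof. by rewrite /det2 !mxE; ring. Qed.

Lemma det20r u : det2 u 0 = 0.
Proof. by rewrite /det2 !mxE; ring. Qed.

Lemma det2Dl u v q : det2 (u + v) q = det2 u q + det2 v q.
Proof. by rewrite /det2 !mxE; ring. Qed.

Lemma det2Dr u v q : det2 q (u + v) = det2 q u + det2 q v.
Proof. by rewrite /det2 !mxE; ring. Qed.

Lemma det2Zl k u q : det2 (k *: u) q = k * det2 u q.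
Proof. by rewrite /det2 !mxE; ring. Qed.

Lemma det2Zr k u q : det2 q (k *: u) = k * det2 q u.
Proof. by rewrite /det2 !mxE; ring. Qed.

Lemma det2_pluecker u v p q :
  det2 u v * det2 p q = det2 u p * det2 v q - det2 u q * det2 v p.
Proof. by rewrite /det2; ring. Qed.

Lemma det2_cramer p q u : det2 p q *: u = det2 u q *: p + det2 p u *: q.
Proof.
apply/rowP => i; rewrite !mxE /det2.
by have /orP[/eqP->|/eqP->] : (i == 0) || (i == 1);
  [case: i => -[|[|]] | ring | ring].
Qed.

Lemma det2_decomp p q u : det2 p q != 0 ->
  u = (det2 u q / det2 p q) *: p + (det2 p u / det2 p q) *: q.
Proof.
move=> d0; apply: (scalerI d0); rewrite det2_cramer scalerDr !scalerA.
by congr (_ *: _ + _ *: _); field.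
Qed.

Lemma small_eps (a b c d : R) : 0 < a -> 0 < c ->
  exists e, [/\ 0 < e, 0 < a + e * b & 0 < c + e * d].
Proof.
move=> a0 c0.
have key (x y e : R) : 0 < x -> 0 < e -> e <= x / (`|y| + 1) -> 0 < x + e * y.
  move=> x0 e0; have y1 : 0 < `|y| + 1 by have := normr_ge0 y; lra.
  rewrite ler_pdivlMr // => le.
  have : - (e * `|y|) <= e * y by rewrite -mulrN ler_pM2l // lerNl ler_normr lexx orbT.
  by nra.
have pos (x y : R) : 0 < x -> 0 < x / (`|y| + 1).
  by move=> x0; apply: divr_gt0 => //; have := normr_ge0 y; lra.
exists (Num.min (a / (`|b| + 1)) (c / (`|d| + 1))).
have e0 : 0 < Num.min (a / (`|b| + 1)) (c / (`|d| + 1)) by rewrite lt_min !pos.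
by split=> //; apply: key => //; rewrite ge_min lexx ?orbT.
Qed.

(** If the second sector starts in the half open first one, tilting [p'] slightly towards [q'] gives
    a direction interior to both. *)
Lemma cones_overlap p q p' q' :
    0 < det2 p q -> 0 < det2 p' q' -> 0 <= det2 p p' -> 0 < det2 p' q ->
  exists u, [/\ 0 < det2 p u, 0 < det2 u q, 0 < det2 p' u & 0 < det2 u q'].
Proof.
move=> pq pq' pp' p'q.
have [e [e0 e1 e2]] : exists e, [/\ 0 < e, 0 < det2 p' q + e * det2 q' q &
    0 < det2 p p' + e * det2 p q'].
  move: pp'; rewrite le_eqVlt => /orP[/eqP pp'|pp'].
    have pq'0 : 0 < det2 p q'.
      have := det2_pluecker p q' p' q; rewrite -pp' mul0r sub0r (det2C q') => E.
      by rewrite -(pmulr_lgt0 _ p'q) E mulrN opprK mulr_gt0.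
    have [e [e0 e1 _]] := small_eps (det2 q' q) 0 p'q ltr01.
    by exists e; split=> //; rewrite -pp' add0r mulr_gt0.
  by have [e [e0 e1 e2]] := small_eps (det2 q' q) (det2 p q') p'q pp'; exists e.
exists (p' + e *: q'); rewrite !det2Dl !det2Dr !det2Zl !det2Zr !det2vv.
by split=> //; rewrite ?mulr0 ?addr0 ?add0r ?mulr_gt0.
Qed.

End Plane.

Lemma sum_porbit (T : finType) (V : nmodType) (s : {perm T}) (F : T -> V) x :
  \sum_(i < #|porbit s x|) F (iter i s x) = \sum_(y in porbit s x) F y.
Proof.
rewrite -[RHS]big_enum /=.
rewrite [RHS](perm_big (traject s x #|porbit s x|)) /=; last first.
  apply: uniq_perm; rewrite ?enum_uniq ?uniq_traject_porbit // => y.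
  by rewrite mem_enum porbit_traject.
rewrite -(big_mkord xpredT (fun i => F (iter i s x))) /=.
have -> : traject s x #|porbit s x| = [seq iter i s x | i <- iota 0 #|porbit s x|].
  apply: (@eq_from_nth _ x); rewrite ?size_traject ?size_map ?size_iota // => i ilt.
  by rewrite nth_traject // (nth_map 0%N) ?size_iota // nth_iota.
by rewrite big_map /index_iota subn0.
Qed.
(** * The universal cover and the rhombic embedding *)

Section Cover.
Variables (D : dimer) (o : Q0 D).
Implicit Types (x y : Q1t D) (a : Q1 D).

Lemma cover_tbnext x : cover_arrow o x -> cover_arrow o (tbnext x).
Proof.
move=> [z /= zE xE]; exists (z + single int x.1) => /=; last first.
  by rewrite linearD /= -xE.
by rewrite linearD /= zE bd1_single addrC addrA subrK.
Qed.

Lemma cover_twnext x : cover_arrow o x -> cover_arrow o (twnext x).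
Proof.
move=> /cover_tbnext [z /= zE xE]; exists z => //=.
by rewrite arrow_tail_wnext.
Qed.

Lemma cover_head_twnext x : cover_tail (twnext x) = cover_head x.
Proof. by rewrite /cover_tail /cover_head /= arrow_tail_wnext. Qed.

Lemma cover_arrow_ex a : exists g, cover_arrow o (a, g).
Proof.
have [z zE] := connected_chain int o (arrow_tail a).
by exists (chain_class z); exists z.
Qed.

Lemma cover_arrow_diff a g g' :
  cover_arrow o (a, g) -> cover_arrow o (a, g') -> H1 D int (g' - g).
Proof.
move=> [z zE /= ->] [z' z'E /= ->]; exists (z' - z); last by rewrite linearB.
by rewrite /= linearB /= zE z'E subrr.
Qed.

Lemma iter_tbnext k x : iter k (@tbnext D) x =
  (iter k (bnext D) x.1, x.2 + \sum_(i < k) arrow_class int (iter i (bnext D) x.1)).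
Proof.
elim: k => [|k IH]; first by rewrite big_ord0 addr0; case: x.
by rewrite iterS IH /tbnext /= big_ord_recr /= addrA.
Qed.

Lemma iter_twnext k x : iter k (@twnext D) x =
  (iter k (wnext D) x.1, x.2 + \sum_(i < k) arrow_class int (iter i (wnext D) x.1)).
Proof.
elim: k => [|k IH]; first by rewrite big_ord0 addr0; case: x.
by rewrite iterS IH /twnext /= big_ord_recr /= addrA.
Qed.

Lemma sum_face f : \sum_(y in boundary f) arrow_class int y = 0 :> C1B D int.
Proof.
rewrite /arrow_class -linear_sum /= -(linear0 (@chain_class D int)).
apply/chain_classP; exists (single int f).
apply/ffunP => a; rewrite subr0 sum_ffunE ffunE.
have -> : \sum_(x in boundary f) single int x a = (a \in boundary f)%:R.
  case: (boolP (a \in boundary f)) => af.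
    rewrite (bigD1 a) //= singleE eqxx big1 ?addr0 // => x /andP[_ /negPf xa].
    by rewrite singleE eq_sym xa.
  rewrite big1 // => x xf; rewrite singleE.
  by case: eqP xf af => // ->  ->.
rewrite big_mkcond (bigD1 f) //= singleE eqxx big1 ?addr0.
  by case: ifP.
by move=> f' /negPf f'f; rewrite singleE f'f; case: ifP.
Qed.

(** The boundary of a face has class 0, so a black face lifts to a closed cycle of the same length
    in the universal cover. *)
Lemma tbnext_period x : iter #|porbit (bnext D) x.1| (@tbnext D) x = x.
Proof.
rewrite iter_tbnext iter_porbit sum_porbit.
by rewrite (sum_face (bface_of x.1)) addr0; case: x.
Qed.

Lemma twnext_period x : iter #|porbit (wnext D) x.1| (@twnext D) x = x.
Proof.
rewrite iter_twnext iter_porbit sum_porbit.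
by rewrite (sum_face (wface_of x.1)) addr0; case: x.
Qed.

Lemma iter_face (T : Type) (f : T -> T) n (x : T) :
  (0 < n)%N -> iter n f x = x -> [set y | exists k, y = iter k f (f x)] =
    [set y | exists k, y = iter k f x].
Proof.
move=> n0 nx; apply/seteqP; split=> _ [k ->].
  by exists k.+1; rewrite iterSr.
by exists (k + n.-1)%N; rewrite -iterSr -addnS prednK // iterD nx.
Qed.

Lemma bface_tbnext x : bface (tbnext x) = bface x.
Proof.
apply: iter_face (tbnext_period x); apply/card_gt0P; exists x.1; exact: porbit_id.
Qed.

Lemma wface_twnext x : wface (twnext x) = wface x.
Proof.
apply: iter_face (twnext_period x); apply/card_gt0P; exists x.1; exact: porbit_id.
Qed.

Lemma bface_iter k x : bface (iter k (@tbnext D) x) = bface x.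
Proof. by elim: k => //= k <-; rewrite bface_tbnext. Qed.

Lemma wface_iter k x : wface (iter k (@twnext D) x) = wface x.
Proof. by elim: k => //= k <-; rewrite wface_twnext. Qed.

Lemma cover_iter_tbnext k x : cover_arrow o x -> cover_arrow o (iter k (@tbnext D) x).
Proof. by move=> xo; elim: k => //= k; exact: cover_tbnext. Qed.

Lemma cover_iter_twnext k x : cover_arrow o x -> cover_arrow o (iter k (@twnext D) x).
Proof. by move=> xo; elim: k => //= k; exact: cover_twnext. Qed.

End Cover.

(** * Directions and sectors of the rhombi *)

Section Geometry.
Variables (R : realType) (D : dimer) (o : Q0 D).

Lemma cones_meet (p q p' q' u : 'rV[R]_2) :
    0 < det2 p u -> 0 < det2 u q -> 0 < det2 p' u -> 0 < det2 u q' ->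
    0 < det2 p q -> 0 < det2 p' q' ->
  exists s t s' t' : R, [/\ 0 < s < 1, 0 < t < 1, 0 < s' < 1, 0 < t' < 1 &
    s *: p + t *: q = s' *: p' + t' *: q'].
Proof.
move=> pu uq pu' uq' pq pq'.
pose s := det2 u q / det2 p q; pose t := det2 p u / det2 p q.
pose s' := det2 u q' / det2 p' q'; pose t' := det2 p' u / det2 p' q'.
have s0 : 0 < s by apply: divr_gt0.
have t0 : 0 < t by apply: divr_gt0.
have s0' : 0 < s' by apply: divr_gt0.
have t0' : 0 < t' by apply: divr_gt0.
have E : s *: p + t *: q = s' *: p' + t' *: q'.
  rewrite -[LHS](@det2_decomp R p q u) ?gt_eqF //.
  by rewrite -[RHS](@det2_decomp R p' q' u) ?gt_eqF.
clearbody s t s' t'.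
(* The denominator exceeds all four coefficients, so scaling by [e] brings the common vector into
   both open parallelograms. *)
pose e := (1 + s + t + s' + t')^-1.
have d0 : 0 < 1 + s + t + s' + t' by lra.
have e01 z : 0 < z -> z < 1 + s + t + s' + t' -> 0 < e * z < 1.
  move=> z0 zlt; rewrite mulr_gt0 ?invr_gt0 //=.
  by rewrite mulrC ltr_pdivrMr // mul1r.
exists (e * s), (e * t), (e * s'), (e * t').
split; try (by apply: e01; lra).
by rewrite -!scalerA -!scalerDr E.
Qed.

(** Take for [w a] the side of the rhombus of [a] from its tail to its white corner; the other side
    at the tail is [- w (bprev a)]. Seen from the black corner the rhombus fills the sector from
    [w (bprev a)] to [w a], and from the white corner the opposite sector, so disjointness of cells
    separates the sectors at a face. The last two claims say that a face of the cover passes a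
    vertex only once: two edges of the quad graph with the same ends have the same image. *)
Lemma geometry : geometrically_consistent R o ->
  exists w : Q1 D -> 'rV[R]_2,
  [/\ forall a, w (zz_next a) = w a,
      forall a, 0 < det2 (w (bprev a)) (w a),
      forall f a a', a \in boundary f -> a' \in boundary f -> a != a' ->
        0 <= det2 (w (bprev a)) (w (bprev a')) -> ~ 0 < det2 (w (bprev a')) (w a),
      forall x y, cover_arrow o x -> bface x y -> cover_head x = cover_tail y ->
        y = tbnext x
    & forall x y, cover_arrow o x -> wface x y -> cover_head x = cover_tail y ->
        y = twnext x].
Proof.
move=> [pV [pB [pW [[rho rhoP] _ headP cellP]]]].
have cell_inj c c' p : is_quad_cell o c -> is_quad_cell o c' ->
    cell_image pV pB pW c p -> cell_image pV pB pW c' p -> c = c'.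
  move=> cP c'P cp c'p; have [c0 [_ c0P]] := cellP p.
  by rewrite -(c0P c) // -(c0P c').
pose lift a : Q1t D := (a, projT1 (cid (cover_arrow_ex o a))).
have liftP a : cover_arrow o (lift a) by rewrite /lift /=; case: cid.
pose om a := pW (wface (lift a)) - pV (cover_tail (lift a)).
pose be a := pB (bface (lift a)) - pV (cover_tail (lift a)).
(* Two lifts of an arrow differ by a deck transformation, which acts on the embedding as a
   translation. *)
have indep x : cover_arrow o x ->
    pW (wface x) - pV (cover_tail x) = om x.1 /\
    pB (bface x) - pV (cover_tail x) = be x.1.
  case: x => a g xo; have lo := liftP a.
  have hH := cover_arrow_diff lo xo.
  have [tV tB tW] := rhoP _ _ hH lo.
  have xE : translate (g - (lift a).2) (lift a) = (a, g).
    by rewrite /translate /= addrC subrK.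
  by rewrite -xE tV tB tW /om /be !opprD; split; rewrite addrACA subrr addr0.
have headE x : cover_arrow o x ->
    pV (cover_head x) = pW (wface x) + be x.1 /\
    pV (cover_head x) = pB (bface x) + om x.1.
  move=> xo; have [hE _] := headP _ xo; have [oE bE] := indep _ xo.
  have hE' : pV (cover_head x) = pW (wface x) + be x.1.
    by rewrite -bE -hE addrC subrK.
  split=> //; rewrite hE' -(subrK (pV (cover_tail x)) (pW _)) oE.
  by rewrite -(subrK (pV (cover_tail x)) (pB _)) bE addrC addrA addrAC.
have det_pos a : 0 < det2 (om a) (be a) by have [] := headP _ (liftP a).
have be_b a : be (bnext D a) = - om a.
  have lo := liftP a; have [_ <-] := indep _ (cover_tbnext lo).
  by rewrite bface_tbnext (headE _ lo).2 opprD addrA subrr add0r.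
have om_w a : om (wnext D a) = - be a.
  have lo := liftP a; have [<- _] := indep _ (cover_twnext lo).
  by rewrite cover_head_twnext wface_twnext (headE _ lo).1 opprD addrA subrr add0r.
have be_tau a : be a = - om (bprev a) by rewrite -be_b bnext_bprev.
have det_tau a : 0 < det2 (om (bprev a)) (om a).
  by have := det_pos a; rewrite be_tau /det2 !mxE; lra.
exists om; split=> //.
- by move=> a; rewrite zz_nextE om_w be_b opprK.
- move=> f a a' af a'f aa' e0 e1.
  have [u [u1 u2 u3 u4]] := cones_overlap (det_tau a) (det_tau a') e0 e1.
  have [s [t [s' [t' [s01 t01 s01' t01' E]]]]] :=
    cones_meet u1 u2 u3 u4 (det_tau a) (det_tau a').
  have s01C : 0 < 1 - s < 1 by lra.
  have t01C : 0 < 1 - t < 1 by lra.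
  have s01C' : 0 < 1 - s' < 1 by lra.
  have t01C' : 0 < 1 - t' < 1 by lra.
  have quadB x r1 r2 : cover_arrow o x -> 0 < r1 < 1 -> 0 < r2 < 1 ->
      cell_image pV pB pW (Quad x)
       (pB (bface x) + (r1 *: om (bprev x.1) + r2 *: om x.1)).
    move=> xo r01 r02; exists r2, (1 - r1); split=> //; first by lra.
    have [-> bE] := indep _ xo; rewrite bE -(subrK (pV (cover_tail x)) (pB _)) bE.
    by rewrite be_tau; apply/rowP => i; rewrite !mxE; ring.
  have quadW x r1 r2 : cover_arrow o x -> 0 < r1 < 1 -> 0 < r2 < 1 ->
      cell_image pV pB pW (Quad x)
       (pW (wface x) - (r1 *: om (bprev x.1) + r2 *: om x.1)).
    move=> xo r01 r02; exists (1 - r2), r1; split=> //; first by lra.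
    have [oE ->] := indep _ xo; rewrite oE -(subrK (pV (cover_tail x)) (pW _)) oE.
    by rewrite be_tau; apply/rowP => i; rewrite !mxE; ring.
  have lo := liftP a; move: af a'f; case: f => f af a'f.
  + have := a'f; rewrite (boundaryE af) /= /bprev porbitV => /porbitP[k a'E].
    have lo' := cover_iter_tbnext k lo.
    have l1 : (iter k (@tbnext D) (lift a)).1 = a' by rewrite iter_tbnext /= a'E permX.
    have := quadB _ _ _ lo s01 t01; rewrite E => q1.
    have := quadB _ _ _ lo' s01' t01'; rewrite bface_iter l1 => q2.
    have [] := cell_inj (Quad _) (Quad _) _ lo lo' q1 q2 => lE.
    by move/eqP: aa'; apply; rewrite -l1 -lE.
  + have := a'f; rewrite (boundaryE af) /= => /porbitP[k a'E].
    have lo' := cover_iter_twnext k lo.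
    have l1 : (iter k (@twnext D) (lift a)).1 = a' by rewrite iter_twnext /= a'E permX.
    have := quadW _ _ _ lo s01 t01; rewrite E => q1.
    have := quadW _ _ _ lo' s01' t01'; rewrite wface_iter l1 => q2.
    have [] := cell_inj (Quad _) (Quad _) _ lo lo' q1 q2 => lE.
    by move/eqP: aa'; apply; rewrite -l1 -lE.
- move=> x y xo [k yE] hx.
  have yo : cover_arrow o y by rewrite yE; exact: cover_iter_tbnext.
  pose p := (1 - 2^-1) *: pV (cover_tail y) + 2^-1 *: pB (bface y).
  have p1 : cell_image pV pB pW (BEdge y) p by exists 2^-1 => //; lra.
  have p2 : cell_image pV pB pW (BEdge (tbnext x)) p.
    by exists 2^-1; [lra | rewrite bface_tbnext /p -hx yE bface_iter].
  by have [] := cell_inj (BEdge _) (BEdge _) _ yo (cover_tbnext xo) p1 p2.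
- move=> x y xo [k yE] hx.
  have yo : cover_arrow o y by rewrite yE; exact: cover_iter_twnext.
  pose p := (1 - 2^-1) *: pV (cover_tail y) + 2^-1 *: pW (wface y).
  have p1 : cell_image pV pB pW (WEdge y) p by exists 2^-1 => //; lra.
  have p2 : cell_image pV pB pW (WEdge (twnext x)) p.
    by exists 2^-1; [lra | rewrite wface_twnext cover_head_twnext /p -hx yE wface_iter].
  by have [] := cell_inj (WEdge _) (WEdge _) _ yo (cover_twnext xo) p1 p2.
Qed.

End Geometry.
(** * Zigzag flows *)

Section Flows.
Variables (D : dimer) (o : Q0 D).
Implicit Types (x y : Q1t D) (a : Q1 D) (eta : int -> Q1t D) (n j : int).

Lemma int_parity n : exists j, n = 2 * j \/ n = 2 * j + 1.
Proof. by exists (n %/ 2)%Z; lia. Qed.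

Lemma int_iter (T : Type) (s : T -> T) (e : int -> T) j (k : nat) :
  (forall j, e (j + 1) = s (e j)) -> e (j + k%:Z) = iter k s (e j).
Proof.
move=> eS; elim: k => [|k IH]; first by rewrite addr0.
by rewrite iterS -IH -eS; congr e; lia.
Qed.

Lemma int_porbit (T : finType) (s : {perm T}) (e : int -> T) j :
  (forall j, e (j + 1) = s (e j)) -> e j \in porbit s (e 0).
Proof.
move=> eS; case: j => k.
  by rewrite -[Posz k]add0r (int_iter _ _ eS) -permX mem_porbit.
rewrite porbit_sym; have -> : e 0 = iter k.+1 s (e (Negz k)).
  by rewrite -(int_iter _ _ eS); congr e; lia.
by rewrite -permX mem_porbit.
Qed.

Definition tbprev x : Q1t D := (bprev x.1, x.2 - arrow_class int (bprev x.1)).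
Definition twprev x : Q1t D :=
  ((wnext D)^-1%g x.1, x.2 - arrow_class int ((wnext D)^-1%g x.1)).

Lemma tbprevK x : tbnext (tbprev x) = x.
Proof. by case: x => a g; rewrite /tbnext /= bnext_bprev subrK. Qed.

Lemma twprevK x : twnext (twprev x) = x.
Proof. by case: x => a g; rewrite /twnext /= permKV subrK. Qed.

Lemma iter_back (T : Type) (f : T -> T) (k : nat) (y : T) :
  (0 < k)%N -> iter k f y = y -> y = iter k.-1 f (f y).
Proof. by move=> k0; rewrite -iterSr prednK. Qed.

(** A step back equals going forward round the rest of the closed face. *)
Lemma cover_tbprev x : cover_arrow o x -> cover_arrow o (tbprev x).
Proof.
move=> xo; rewrite (iter_back _ (tbnext_period (tbprev x))).
  by rewrite tbprevK; exact: cover_iter_tbnext.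
by apply/card_gt0P; exists (tbprev x).1; exact: porbit_id.
Qed.

Lemma cover_twprev x : cover_arrow o x -> cover_arrow o (twprev x).
Proof.
move=> xo; rewrite (iter_back _ (twnext_period (twprev x))).
  by rewrite twprevK; exact: cover_iter_twnext.
by apply/card_gt0P; exists (twprev x).1; exact: porbit_id.
Qed.

Lemma flow_ex x : cover_arrow o x ->
  exists eta, [/\ zigzag_flow o eta, eta 0 = x & eta 1 = tbnext x].
Proof.
move=> xo; pose F y := twnext (tbnext y); pose G y := tbprev (twprev y).
have GK y : F (G y) = y by rewrite /F /G tbprevK twprevK.
pose e j := match j with Posz k => iter k F x | Negz k => iter k.+1 G x end.
have eS j : e (j + 1) = F (e j).
  case: j => [k|[|k]]; last 2 first.
  - by rewrite [_ + _](_ : _ = 0) //= GK.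
  - have -> : Negz k.+1 + 1 = Negz k by lia.
    by rewrite /e (iterS k.+1) GK.
  - by have -> : Posz k + 1 = Posz k.+1 by lia.
have eo j : cover_arrow o (e j).
  case: j => k; elim: k => [|k IH] //=.
  - exact/cover_twnext/cover_tbnext.
  - exact/cover_tbprev/cover_twprev.
  - exact/cover_tbprev/cover_twprev.
pose eta n := if (n %% 2)%Z == 0 then e (n %/ 2)%Z else tbnext (e (n %/ 2)%Z).
have eta0 j : eta (2 * j) = e j.
  rewrite /eta; have -> : ((2 * j) %% 2)%Z = 0 by lia.
  by have -> : ((2 * j) %/ 2)%Z = j by lia.
have eta1 j : eta (2 * j + 1) = tbnext (e j).
  rewrite /eta; have -> : ((2 * j + 1) %% 2)%Z = 1 by lia.
  by have -> : ((2 * j + 1) %/ 2)%Z = j by lia.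
have eta2 j : eta (2 * j - 1) = tbnext (e (j - 1)) by rewrite -eta1; congr eta; lia.
exists eta; split; [ | exact: (eta0 0) | exact: (eta1 0)].
split=> n.
- have [j [->|->]] := int_parity n; rewrite ?eta0 ?eta1 //.
  exact: cover_tbnext.
- have [j [->|->]] := int_parity n; first by rewrite eta0 eta1.
  have -> : 2 * j + 1 + 1 = 2 * (j + 1) by lia.
  by rewrite eta0 eta1 eS cover_head_twnext.
- by rewrite eta0 eta1; exists 1%N.
- by rewrite eta0 eta2 -{2}(subrK 1 n) eS; exists 1%N.
Qed.

Section Period.
Hypothesis flowb : forall x y, cover_arrow o x -> bface x y ->
  cover_head x = cover_tail y -> y = tbnext x.
Hypothesis floww : forall x y, cover_arrow o x -> wface x y ->
  cover_head x = cover_tail y -> y = twnext x.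
Hypothesis bprev_zz : forall a, bprev a \notin zz a.
Variable eta : int -> Q1t D.
Hypothesis etaP : zigzag_flow o eta.

(** A flow is only required to stay on the same face with matching head and tail; [flowb] turns this
    into a definite successor. *)
Lemma flow_odd j : eta (2 * j + 1) = tbnext (eta (2 * j)).
Proof. by case: etaP => eo eh eb _; apply: flowb. Qed.

Lemma flow_even j : eta (2 * (j + 1)) = twnext (eta (2 * j + 1)).
Proof.
case: etaP => eo eh _ ew; have E : 2 * (j + 1) - 1 = 2 * j + 1 :> int by lia.
apply: floww => //; first by rewrite -E; exact: ew.
by rewrite eh; congr (cover_tail (eta _)); lia.
Qed.

Definition flow_zigs j : Q1 D := (eta (2 * j)).1.

Lemma flow_zigsS j : flow_zigs (j + 1) = zz_next (flow_zigs j).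
Proof. by rewrite /flow_zigs flow_even flow_odd zz_nextE. Qed.

Lemma flow_zigs_zz j : flow_zigs j \in zz (eta 0).1.
Proof. exact: (@int_porbit _ zz_next flow_zigs j flow_zigsS). Qed.

Lemma flow_zags j : (eta (2 * j + 1)).1 = bnext D (flow_zigs j).
Proof. by rewrite flow_odd. Qed.

Lemma flow_arrow n :
  (eta n).1 \in zz (eta 0).1 \/ bprev (eta n).1 \in zz (eta 0).1.
Proof.
have [j [->|->]] := int_parity n; first by left; exact: flow_zigs_zz.
by right; rewrite flow_zags bprevK flow_zigs_zz.
Qed.

Lemma zz_periodE : zz_period eta = (#|zz (eta 0).1|).*2.
Proof.
set k := #|_|; have k0 : (0 < k)%N by apply/card_gt0P; exists (eta 0).1; exact: zz_refl.
have zk j : flow_zigs (j + k%:Z) = flow_zigs j.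
  rewrite (int_iter _ _ flow_zigsS) /k -(zz_eq (flow_zigs_zz j)).
  exact: iter_porbit.
have kP : is_period eta k.*2.
  split; first by rewrite double_gt0.
  move=> n; have [j [->|->]] := int_parity n.
    by rewrite (_ : 2 * j + _ = 2 * (j + k%:Z)); [exact: zk | lia].
  rewrite (_ : 2 * j + 1 + _ = 2 * (j + k%:Z) + 1); last lia.
  by rewrite !flow_zags zk.
have kmin i : is_period eta i -> (k.*2 <= i)%N.
  (* An odd period would make the initial even arrow an odd arrow of its own zigzag path, against
     [bprev_zz]. *)
  move=> [i0 iP]; have [j [jE|jE]] := int_parity i%:Z; last first.
    have := iP 0; rewrite add0r jE flow_zags => E.
    have /negP[] := bprev_zz (eta 0).1.
    by rewrite -{1}E bprevK flow_zigs_zz.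
  have [l lE] : exists l : nat, j = l%:Z by exists `|j|%N; lia.
  have il : i = l.*2 by lia.
  have /esym := iP 0; rewrite add0r jE lE -[RHS]/(flow_zigs l%:Z) -[l%:Z]add0r.
  rewrite (int_iter _ _ flow_zigsS) -[(eta 0).1]/(flow_zigs 0) => zl.
  rewrite il leq_double /k leqNgt; apply/negP => lk.
  have l0 : (0 < l)%N by lia.
  have un := uniq_traject_porbit zz_next (eta 0).1.
  have := @nth_uniq _ (eta 0).1 _ l 0%N _ _ un.
  rewrite size_traject !nth_traject //= => /(_ lk k0) /esym.
  by rewrite -zl eqxx; case: l l0 {lE il zl lk}.
rewrite /zz_period; case: xgetP => [i _ [iP imin]|]; last by move=> /(_ k.*2) [].
by apply/eqP; rewrite eqn_leq imin // kmin.
Qed.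

Lemma zz_classE (K : comNzRingType) :
  zz_class K eta = chain_class (zz_chain K (eta 0).1).
Proof.
rewrite /zz_class zz_periodE zz_chainE linear_sum /=.
rewrite -(sum_porbit zz_next (fun y : Q1 D => chain_class (single K y + single K (bnext D y)))).
rewrite -/(zz _); set k := #|_|.
have zE (i : nat) : (eta (i.*2)%:Z).1 = iter i zz_next (eta 0).1.
  rewrite -[(eta 0).1]/(flow_zigs 0) -(int_iter _ _ flow_zigsS) add0r.
  by congr (eta _).1; lia.
have zE1 (i : nat) : (eta (i.*2.+1)%:Z).1 = bnext D (iter i zz_next (eta 0).1).
  rewrite -zE (_ : (i.*2.+1)%:Z = 2 * i%:Z + 1); last by lia.
  by rewrite flow_zags /flow_zigs; congr (bnext D (eta _).1); lia.
elim: k => [|k IH]; first by rewrite !big_ord0.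
rewrite doubleS !big_ord_recr /= IH -addrA zE zE1 linearD /=.
by [].
Qed.

End Period.
End Flows.

(** * Primitivity of the zigzag classes *)

Section Primitive.
Variable D : dimer.
Implicit Types (a c x y : Q1 D) (f : Q2 D).

Lemma d1_single (K : comNzRingType) x :
  d1 (single K x) = single K (bface_of x) + single K (wface_of x).
Proof.
apply/ffunP => f; rewrite !ffunE !singleE.
have sumE (T : finType) (A : {set T}) (y : T) :
    \sum_(z in A) (z == y)%:R = (y \in A)%:R :> K.
  rewrite big_mkcond (bigD1 y) //= eqxx big1 ?addr0; first by case: ifP.
  by move=> z /negPf ->; case: ifP.
under eq_bigr do rewrite singleE.
rewrite [LHS]sumE; transitivity (\sum_(f' | x \in boundary f') (f' == f)%:R : K).
  rewrite big_mkcond (bigD1 f) //= eqxx big1 ?addr0; first by case: ifP.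
  by move=> f' /negPf ->; case: ifP.
by rewrite sum_faces ![_ == f]eq_sym.
Qed.

Hypothesis face_zz : forall f a a', a \in boundary f -> a' \in boundary f ->
  a' \in zz a -> a' = a.
Hypothesis cross : forall a, pairing (zz_cocycle int a) (zz_chain int (bnext D a)) != 0.

Lemma bprev_notin a x : x \in zz a -> bprev x \notin zz a.
Proof.
move=> xa; apply/negP => tx.
have := face_zz (f := bface_of x) (a := x) (a' := bprev x) (bface_ofP x).
rewrite (zz_eq xa) => /(_ _ tx).
have := boundary_prev (bface_of x) x; rewrite bface_ofP /= => -> /(_ isT) E.
by have := prev_neq (bface_of x) x; rewrite /= E eqxx.
Qed.

Section Dual.
Variable a : Q1 D.

(* [v] is a path in the dual graph from the white face of [x] to that of [y], and
   [n] is the intersection number of the zigzag path of [a] with a parallel path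
   in the quiver. *)
Definition slide x y (n : int) := exists2 v : {ffun Q1 D -> int^o},
  d1 v = single int (wface_of y) - single int (wface_of x) &
  pairing v (zz_chain int a) = (y \in zz a)%:R - (x \in zz a)%:R - n.

Lemma slide_refl x : slide x x 0.
Proof. by exists 0; [rewrite linear0 subrr | rewrite pairing0l !subrr]. Qed.

Lemma slide_sym x y n : slide x y n -> slide y x (- n).
Proof.
move=> [v vE pE]; exists (- v); first by rewrite linearN /= vE opprB.
by rewrite pairingNl pE; ring.
Qed.

Lemma slide_trans y x z n m : slide x y n -> slide y z m -> slide x z (n + m).
Proof.
move=> [v vE pE] [u uE qE]; exists (v + u).
  by rewrite linearD /= vE uE addrC addrA subrK.
by rewrite pairingDl pE qE; ring.
Qed.

(** [wnext D (bprev x)] is the next arrow leaving the tail of [x]; the dual path crosses [x] into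
    its black face and leaves that face across [bprev x]. *)
Lemma slide_rot x : slide x (wnext D (bprev x)) 0.
Proof.
exists (single int (bprev x) - single int x).
  have xE : bface_of x = bface_of (bprev x) by rewrite -{1}(bnext_bprev x) bface_of_bnext.
  by rewrite linearB /= !d1_single wface_of_wnext xE opprD addrACA subrr add0r.
rewrite pairingDl pairingNl !pairing_singlel !ffunE zz_wnext /=.
by ring.
Qed.

Lemma slide_wnext x : slide x (wnext D x) (zz_cocycle int a x).
Proof.
exists 0; first by rewrite linear0 wface_of_wnext subrr.
by rewrite pairing0l ffunE zz_wnext; ring.
Qed.

Lemma slide_bnext x : slide x (bnext D x) (zz_cocycle int a x).
Proof.
have := slide_rot (bnext D x); rewrite bprevK => /slide_sym; rewrite oppr0 => h.
by have := slide_trans (slide_wnext x) h; rewrite addr0.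
Qed.

(** To pass from [x] to [zz_next x], go round the black face of [x] the long way, avoiding [x] and
    [bnext D x], and turn at the vertex. By [face_zz] the path meets this face only in the two
    avoided arrows, so nothing is crossed on the way. *)
Lemma slide_zz x : x \in zz a -> slide a x 0.
Proof.
move: x; apply: zz_ind => [|x xa IH]; first exact: slide_refl.
rewrite -[0]addr0; apply: slide_trans IH _.
pose y := bnext D (bnext D x).
have yZ : slide y (zz_next x) 0.
  by rewrite zz_nextE; have := slide_rot y; rewrite bprevK.
suff xy : slide y x 0.
  have := slide_trans (slide_sym xy) yZ; by rewrite oppr0 addr0.
have kex : exists k, iter k (bnext D) y == x.
  have /porbitP[k ->] : x \in porbit (bnext D) y.
    rewrite porbit_sym; have := mem_porbit (bnext D) 2 x.
    by rewrite expgS expg1 permM.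
  by exists k; rewrite permX.
have [k /eqP kE kmin] := ex_minnP kex.
have yface i : iter i (bnext D) y \in boundary (bface_of x).
  rewrite /= -permX /y -!permM -!expgS; exact: mem_porbit.
have step i : (i < k)%N -> zz_cocycle int a (iter i (bnext D) y) = 0.
  move=> ik; set c := iter i _ _.
  have cx : c != x by apply/negP => /kmin; rewrite leqNgt ik.
  have cbx : bprev c != x.
    apply: contraTneq ik => tc; rewrite -leqNgt; case: i @c {cx} tc => [|i] /=.
      by rewrite bprevK => /eqP; rewrite (negPf (bvalence x)).
    by rewrite bprevK => /eqP /kmin; exact: leqW.
  have cF (c' : Q1 D) : c' \in boundary (bface_of x) -> c' != x -> c' \notin zz a.
    move=> c'F; apply: contraNN => c'a; apply/eqP.
    by apply: (face_zz (bface_ofP x)) => //; rewrite (zz_eq xa).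
  have tcF : bprev c \in boundary (bface_of x).
    by have := boundary_prev (bface_of x) c; rewrite /= => ->; exact: yface.
  by rewrite ffunE (negPf (cF _ (yface i) cx)) (negPf (cF _ tcF cbx)).
rewrite -kE; elim: {-2}k (leqnn k) => [_|i IH ik]; first exact: slide_refl.
rewrite -[0]addr0; apply: slide_trans (IH (ltnW ik)) _.
by rewrite -(step i ik); exact: slide_bnext.
Qed.

(** If sliding with number 0 reaches the far end of an even arrow, crossing back over that arrow
    closes a dual curve of intersection number 1. Otherwise the vertices so reached form one side of
    the path, and their indicator [g] has coboundary [zz_cocycle]: the path would separate the torus
    and have intersection number 0 with every cycle, against [cross]. *)
Lemma dual_cocycle_ex :
  exists2 v, d1 v = 0 & `|pairing v (zz_chain int a)| = 1.
Proof.
suff [x xa hx] : exists2 x, x \in zz a & slide a (bnext D x) 0.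
  have xN := bprev_notin xa.
  have := slide_trans (slide_trans (slide_zz xa) (slide_bnext x)) (slide_sym hx).
  rewrite oppr0 addr0 add0r ffunE xa (negPf xN) => -[v].
  by rewrite subrr => dv pv; exists v => //; rewrite pv subrr.
apply: contrapT => nh.
pose g : {ffun Q0 D -> int^o} :=
  [ffun v => `[< exists2 c, slide a c 0 & v = arrow_tail c >]%:R].
have slide_vrot x y : arrow_tail x = arrow_tail y -> slide a x 0 -> slide a y 0.
  move=> /(congr1 val) /= /eqP; rewrite eq_sym eq_porbit_mem => /porbitP[k ->] h.
  elim: k => [|k IH]; first by rewrite expg0 perm1.
  rewrite expgSr permM {1}/vrot permM -[0]addr0; apply: slide_trans IH _.
  exact: slide_rot.
have gE x : g (arrow_tail x) = `[< slide a x 0 >]%:R.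
  rewrite ffunE; congr (_%:R); congr nat_of_bool; apply: asbool_equiv_eq; split.
    by move=> [c hc /esym /slide_vrot]; apply.
  by exists x.
have zzN x : x \in zz a -> ~ slide a (bnext D x) 0 by move=> xa hx; apply: nh; exists x.
have ccE : zz_cocycle int a = d0 g.
  apply/ffunP => x; rewrite [RHS]ffunE /arrow_head !gE.
  have [xa|xa] := boolP (x \in zz a).
    rewrite ffunE xa (negPf (bprev_notin xa)) asboolF; last exact: zzN.
    by rewrite asboolT //; exact: slide_zz.
  have [tx|tx] := boolP (bprev x \in zz a).
    rewrite ffunE tx (negPf xa) asboolT; last first.
      have wx : wnext D x \in zz a by rewrite zz_wnext.
      have := slide_rot (bnext D x); rewrite bprevK => /slide_sym.
      by move=> /(slide_trans (slide_zz wx)); rewrite oppr0 addr0.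
    by rewrite asboolF // -{1}(bnext_bprev x); exact: zzN.
  have c0 : zz_cocycle int a x = 0 by rewrite ffunE (negPf tx) (negPf xa) subrr.
  rewrite c0; apply/esym/eqP; rewrite subr_eq0; apply/eqP; congr (_%:R).
  have h := slide_bnext x; rewrite c0 in h.
  congr nat_of_bool; apply: asbool_equiv_eq; split=> hx.
    by rewrite -[0]subr0 -[0 - 0]addr0; apply: slide_trans hx _; rewrite -oppr0; exact: slide_sym.
  by rewrite -[0]addr0; exact: slide_trans hx h.
have := cross a; rewrite ccE pairing_d0 bd1_zz_chain big1 ?eqxx // => v _.
by rewrite [X in _ * X]ffunE mulr0.
Qed.

Lemma primitive_zz_chain : primitive (chain_class (zz_chain int a)).
Proof.
split; first by exists (zz_chain int a) => //; exact: bd1_zz_chain.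
move=> m c' [z zc <-] E; have [v dv pv] := dual_cocycle_ex.
have E' : chain_class (zz_chain int a) = chain_class (z *+ m) by rewrite E raddfMn.
have := pairing_chain_class dv E'.
rewrite -scaler_nat pairingZr => pE; move: pv; rewrite pE normrM.
rewrite normr_nat natz -abszE -PoszM => /eqP.
by rewrite eqz_nat muln_eq1 => /andP[/eqP].
Qed.

End Dual.
End Primitive.
(** * The intersection form on the plane H_1 *)

Section Coordinates.
Variables (R : realType) (D : dimer).
Implicit Types (a x : Q1 D) (f : Q2 D).

(* The directions at a face turn by less than pi at each step and wind once: the
   sectors of two different arrows do not overlap. *)
Definition turning (p : Q1 D -> 'rV[R]_2) : Prop :=
  [/\ forall a, p (zz_next a) = p a,
      forall a, 0 < det2 (p (bprev a)) (p a)
    & forall f a a', a \in boundary f -> a' \in boundary f -> a != a' ->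
        0 <= det2 (p (bprev a)) (p (bprev a')) -> ~ 0 < det2 (p (bprev a')) (p a)].

Variable w : Q1 D -> 'rV[R]_2.
Hypothesis wP : turning w.

Lemma turning_zz (p : Q1 D -> 'rV[R]_2) a x : turning p -> x \in zz a -> p x = p a.
Proof. by move=> [pZ _ _]; exact: zz_fun. Qed.

(** The sector following that of [a] starts in the direction [w a]; two arrows of a face on the same
    path would make two different sectors start on the same ray. *)
Lemma face_zz f a a' :
  a \in boundary f -> a' \in boundary f -> a' \in zz a -> a' = a.
Proof.
move=> af a'f a'a; have [wZ wpos wsep] := wP.
pose n := (prev f)^-1%g; have nK y : prev f (n y) = y by rewrite permKV.
have nf y : y \in boundary f -> n y \in boundary f by move=> yf; rewrite -boundary_prev nK.
have wn y : w (bprev (n y)) = w y by rewrite -(prev_fun f _ wZ) nK.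
apply/eqP/negPn/negP => ne.
apply: (wsep f (n a) (n a')); rewrite ?nf ?wn //.
- by apply: contra_neq ne => /perm_inj.
- by rewrite (turning_zz wP a'a) det2vv.
- by rewrite (turning_zz wP a'a) -wn.
Qed.

Lemma ncross_det a a' : (0 < ncross a a')%N -> 0 < det2 (w a) (w a').
Proof.
move=> /card_gt0P[x]; rewrite finset.inE => /andP[tx xa'].
by rewrite -(turning_zz wP tx) -(turning_zz wP xa'); have [_ ->] := wP.
Qed.

Lemma ncross_bprev x : (0 < ncross (bprev x) x)%N.
Proof. by apply/card_gt0P; exists x; rewrite finset.inE !zz_refl. Qed.

Lemma ncross_asym a a' : (0 < ncross a a')%N -> ncross a' a = 0%N.
Proof.
move=> /ncross_det aa'; apply/eqP; rewrite -leqn0 leqNgt; apply/negP.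
by move=> /ncross_det; rewrite det2C oppr_gt0 ltNge (ltW aa').
Qed.

Lemma cross_neq0 a : pairing (zz_cocycle int a) (zz_chain int (bnext D a)) != 0.
Proof.
have := ncross_bprev (bnext D a); rewrite bprevK => h.
by rewrite pairing_cocycle_chain (ncross_asym h) subr0 pnatr_eq0 -lt0n.
Qed.

Definition intersection a a' : R := pairing (zz_cocycle R a) (zz_chain R a').

Lemma intersection_gt0 a a' : (0 < intersection a a') = (0 < ncross a a')%N.
Proof.
rewrite /intersection pairing_cocycle_chain.
have [aa'|] := ltnP 0 (ncross a a'); first by rewrite (ncross_asym aa') subr0 ltr0n.
by rewrite leqn0 => /eqP ->; rewrite sub0r oppr_gt0 ltNge ler0n.
Qed.

Lemma intersectionC a a' : intersection a a' = - intersection a' a.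
Proof. exact: pairing_cocycle_chainC. Qed.

Lemma intersectionvv a : intersection a a = 0.
Proof. by have := intersectionC a a; lra. Qed.

Variable a0 : Q1 D.

Definition coords (z : {ffun Q1 D -> R^o}) : 'rV[R]_2 :=
  \row_i (if i == 0 then pairing (zz_cocycle R (bprev a0)) z else pairing (zz_cocycle R a0) z).

Definition pt a := coords (zz_chain R a).

Lemma coordsD z z' : coords (z + z') = coords z + coords z'.
Proof. by apply/rowP => i; rewrite !mxE !pairingDr; case: ifP. Qed.

Lemma coordsZ k z : coords (k *: z) = k *: coords z.
Proof. by apply/rowP => i; rewrite !mxE !pairingZr; case: ifP. Qed.

Lemma coords0 z : coords z = 0 ->
  pairing (zz_cocycle R (bprev a0)) z = 0 /\ pairing (zz_cocycle R a0) z = 0.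
Proof.
by move=> /rowP h; have := h 0; have := h 1; rewrite !mxE.
Qed.

Lemma coords_class z z' : chain_class z = chain_class z' -> coords z = coords z'.
Proof.
move=> E; apply/rowP => i; rewrite !mxE.
by rewrite !(@pairing_chain_class D R _ z z') ?d1_zz_cocycle.
Qed.

Let kappa := intersection (bprev a0) a0.

Lemma kappa_gt0 : 0 < kappa.
Proof. by rewrite intersection_gt0 ncross_bprev. Qed.

Lemma coords_inj z z' : bd1 z = 0 -> bd1 z' = 0 -> coords z = coords z' ->
  chain_class z = chain_class z'.
Proof.
move=> dz dz' E; apply/chain_classP.
have [p1 p2] : pairing (zz_cocycle R (bprev a0)) (z - z') = 0 /\ pairing (zz_cocycle R a0) (z - z') = 0.
  by apply: coords0; rewrite -scaleN1r coordsD coordsZ E scaleN1r subrr.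
apply: (@boundary_of_pairing _ _ (zz_cocycle R (bprev a0)) (zz_cocycle R a0) (zz_chain R (bprev a0)) (zz_chain R a0)) => //.
- exact: d1_zz_cocycle.
- exact: d1_zz_cocycle.
- exact: bd1_zz_chain.
- exact: bd1_zz_chain.
- rewrite -!/(intersection _ _) !intersectionvv mul0r sub0r oppr_eq0.
  by rewrite (intersectionC a0) mulrN oppr_eq0 mulf_neq0 // gt_eqF // kappa_gt0.
- by rewrite linearB /= dz dz' subrr.
Qed.

Lemma coords_span a : exists s t, forall v, d1 v = 0 ->
  pairing v (zz_chain R a) = s * pairing v (zz_chain R (bprev a0)) + t * pairing v (zz_chain R a0).
Proof.
have k0 := kappa_gt0.
(* Solves for the coefficients by pairing with the cocycles of [a0] and [bprev a0], whose
   self-intersections are 0. *)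
exists (- intersection a0 a / kappa), (intersection (bprev a0) a / kappa) => v dv.
rewrite -!pairingZr -pairingDr; apply: pairing_chain_class => //.
apply: coords_inj; rewrite ?linearD ?linearZ /= ?bd1_zz_chain ?scaler0 ?addr0 //.
apply/rowP => i; rewrite !mxE !pairingDr !pairingZr -!/(intersection _ _).
rewrite !intersectionvv (intersectionC a0 (bprev a0)) -/kappa !mulr0 addr0 add0r.
by case: ifP => _; field; rewrite gt_eqF.
Qed.

(** An alternating form on a plane is a multiple of the determinant; at the pair [bprev a0], [a0]
    both sides are the square of [kappa]. *)
Lemma det2_pt a a' : det2 (pt a) (pt a') = kappa * intersection a a'.
Proof.
have [s [t E]] := coords_span a; have [s' [t' E']] := coords_span a'.
rewrite /det2 !mxE /= !E ?E' ?d1_zz_cocycle // -!/(intersection _ _).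
rewrite !intersectionvv (intersectionC a0 (bprev a0)) -/kappa.
rewrite [intersection a a']E' ?d1_zz_cocycle // -!/(intersection _ _).
rewrite (intersectionC a) (intersectionC a a0) /intersection !E ?d1_zz_cocycle //.
rewrite -!/(intersection _ _) !intersectionvv (intersectionC a0 (bprev a0)) -/kappa.
by ring.
Qed.

Lemma det2_pt_gt0 a a' : (0 < det2 (pt a) (pt a')) = (0 < ncross a a')%N.
Proof. by rewrite det2_pt pmulr_rgt0 ?kappa_gt0 // intersection_gt0. Qed.

Lemma turning_pt : turning pt.
Proof.
have [wZ wpos wsep] := wP.
have zZ a : pt (zz_next a) = pt a by rewrite /pt (@zz_chain_eq D R a) // zz_next_in zz_refl.
have ppos a : 0 < det2 (pt (bprev a)) (pt a) by rewrite det2_pt_gt0 ncross_bprev.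
have pw a a' : 0 < det2 (pt a) (pt a') -> 0 < det2 (w a) (w a').
  by rewrite det2_pt_gt0; exact: ncross_det.
split=> // f a a' af a'f aa'; rewrite le_eqVlt => /orP[/eqP ee'|ee'] e'q; last first.
  by apply: (wsep f a a') => //; [exact/ltW/pw | exact: pw].
have eq' : 0 < det2 (pt (bprev a)) (pt a').
  have := det2_pluecker (pt (bprev a)) (pt a') (pt (bprev a')) (pt a).
  rewrite -ee' mul0r sub0r (det2C (pt a')) mulrN opprK => E.
  by rewrite -(pmulr_lgt0 _ e'q) E mulr_gt0.
(* Intersection number 0 leaves the order of the two sides open; in the unfavourable order the
   arrows exchange roles, which [eq'] permits. *)
have [ww|ww] := leP 0 (det2 (w (bprev a)) (w (bprev a'))).
  by apply: (wsep f a a') => //; exact: pw.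
apply: (wsep f a' a); rewrite 1?eq_sym //; last exact: pw.
by rewrite det2C oppr_ge0 ltW.
Qed.

Lemma coboundary_of_two c d v : det2 (pt c) (pt d) != 0 -> d1 v = 0 ->
  pairing v (zz_chain R c) = 0 -> pairing v (zz_chain R d) = 0 -> exists g, v = d0 g.
Proof.
move=> cd dv vc vd; apply: coboundary_of_pairing => z dz.
have E := det2_decomp (coords z) cd.
set s := _ / _ in E; set t := _ / _ in E.
rewrite (@pairing_chain_class D R v z (s *: zz_chain R c + t *: zz_chain R d) dv).
  by rewrite pairingDr !pairingZr vc vd !mulr0 addr0.
apply: coords_inj => //; last by rewrite coordsD !coordsZ.
by rewrite linearD !linearZ /= !bd1_zz_chain !scaler0 addr0.
Qed.

End Coordinates.

(** * The cyclic order of the directions around a face *)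

Section Faces.
Variables (R : realType) (D : dimer).
Implicit Types (a x e : Q1 D) (f : Q2 D) (u v q y : 'rV[R]_2).

Lemma det2_pluecker3 u v q y :
  det2 u q * det2 v y = det2 u v * det2 q y + det2 u y * det2 v q.
Proof. by rewrite /det2; ring. Qed.

Lemma det2_trans y u v q : 0 < det2 u y -> 0 < det2 v y -> 0 < det2 q y ->
  0 < det2 u v -> 0 < det2 v q -> 0 < det2 u q.
Proof.
move=> uy vy qy uv vq; rewrite -(pmulr_lgt0 _ vy) det2_pluecker3.
by rewrite addr_gt0 // mulr_gt0.
Qed.

Variable p : Q1 D -> 'rV[R]_2.
Hypothesis pP : turning p.

Let next f := (prev f)^-1%g.

Lemma prev_next f x : prev f (next f x) = x.
Proof. by rewrite permKV. Qed.

Lemma boundary_next f x : (next f x \in boundary f) = (x \in boundary f).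
Proof. by rewrite -{2}(prev_next f x) boundary_prev. Qed.

Lemma turning_prev f x : p (prev f x) = p (bprev x).
Proof. by apply: prev_fun; case: pP. Qed.

Lemma turning_next f x : p (bprev (next f x)) = p x.
Proof. by rewrite -(turning_prev f) prev_next. Qed.

Lemma turning_gt0 x : 0 < det2 (p (bprev x)) (p x).
Proof. by case: pP. Qed.

Lemma turning_next_gt0 f x : 0 < det2 (p x) (p (next f x)).
Proof. by rewrite -(turning_next f) turning_gt0. Qed.

Lemma boundary_ind f (P : Q1 D -> Prop) a :
  a \in boundary f -> P a -> (forall x, x \in boundary f -> P x -> P (next f x)) ->
  forall x, x \in boundary f -> P x.
Proof.
move=> af Pa Pn x; rewrite (boundaryE af) -porbitV => /porbitP[k ->].
suff [] : P (((prev f)^-1 ^+ k)%g a) /\ ((prev f)^-1 ^+ k)%g a \in boundary f by [].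
elim: k => [|k [IH kf]]; first by rewrite expg0 perm1.
by rewrite expgSr permM boundary_next; split=> //; exact: Pn.
Qed.

(** In an open half plane [det2] orders the directions transitively, and the next direction is
    always larger; this cannot go on around a finite face. *)
Lemma turning_half f a y : a \in boundary f ->
  ~ (forall x, x \in boundary f -> 0 < det2 (p x) y).
Proof.
move=> af h.
pose N x := #|[set e in boundary f | 0 < det2 (p e) (p x)]%SET|.
case: (@arg_maxnP _ a [in boundary f] N af) => b bf bmax.
have nf : next f b \in boundary f by rewrite boundary_next.
have := bmax _ nf; rewrite /N /= leqNgt => /negP; apply.
apply/proper_card/properP; split.
  apply/fintype.subsetP => e; rewrite !finset.inE => /andP[ef eb]; rewrite ef /=.
  by apply: (@det2_trans y _ (p b)) => //; [exact: h| exact: h| exact: h | exact: turning_next_gt0].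
by exists b; rewrite !finset.inE bf /= ?turning_next_gt0 // det2vv ltxx.
Qed.

(** If no sector contained [y], the sign of [det2 (p x) y] could never drop from nonnegative to
    negative along the face, so all directions would lie on one side of the line of [y]. *)
Lemma face_sector f a y : a \in boundary f -> y != 0 ->
  exists2 x, x \in boundary f & 0 <= det2 (p (bprev x)) y /\ 0 < det2 y (p x).
Proof.
move=> af y0; apply: contrapT => nh.
have step x : x \in boundary f -> 0 <= det2 (p x) y -> 0 <= det2 (p (next f x)) y.
  move=> xf xy; rewrite leNgt; apply/negP => ny; apply: nh.
  exists (next f x); first by rewrite boundary_next.
  by rewrite turning_next; split=> //; rewrite det2C oppr_gt0.
have [[b [bf bP]]|none] := pselect (exists b, b \in boundary f /\ 0 <= det2 (p b) y).
  have all := boundary_ind bf bP step.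
  apply: (turning_half (y := y) af) => x xf; rewrite lt_neqAle all // andbT eq_sym.
  (* Were [p x] on the line of [y], its predecessor on the nonnegative side would push the successor
     to the other side, hence onto the line too, forcing [y = 0]. *)
  apply/eqP => xy.
  have rf : prev f x \in boundary f by rewrite boundary_prev.
  have ry := all _ rf; have qy := all (next f x); rewrite boundary_next in qy.
  have rx : 0 < det2 (p (prev f x)) (p x) by rewrite turning_prev turning_gt0.
  have xq := turning_next_gt0 f x.
  have E := det2_pluecker (p (prev f x)) (p x) (p (next f x)) y.
  have qy0 : det2 (p (next f x)) y = 0.
    apply/eqP; rewrite eq_le qy // andbT -(pmulr_rle0 _ rx) E xy mulr0 sub0r.
    by rewrite oppr_le0 mulr_ge0 // ltW.
  have := det2_cramer (p x) (p (next f x)) y.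
  rewrite xy (det2C y) qy0 oppr0 !scale0r addr0 => /eqP.
  by rewrite scaler_eq0 gt_eqF //= (negPf y0).
apply: (turning_half (y := - y) af) => x xf; rewrite -scaleN1r det2Zr mulN1r oppr_gt0.
by rewrite ltNge; apply/negP => xy; apply: none; exists x.
Qed.

Lemma face_sector_uniq f a a' y : a \in boundary f -> a' \in boundary f ->
  0 < det2 (p (bprev a)) y -> 0 < det2 y (p a) ->
  0 < det2 (p (bprev a')) y -> 0 < det2 y (p a') -> a = a'.
Proof.
wlog ee' : a a' / 0 <= det2 (p (bprev a)) (p (bprev a')).
  move=> H af a'f ay ya a'y ya'.
  have [h|h] := leP 0 (det2 (p (bprev a)) (p (bprev a'))); first exact: H.
  by apply/esym/H => //; rewrite det2C oppr_ge0 ltW.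
move=> af a'f ay ya a'y ya'; apply/eqP/negPn/negP => ne.
have [_ _ sep] := pP; apply: (sep f a a') => //.
rewrite -(pmulr_lgt0 _ ay) det2_pluecker.
rewrite (det2C _ (p (bprev a))) (det2C _ y) mulrNN (det2C _ (p (bprev a))) mulrN opprK.
by rewrite ltr_wpDl ?mulr_ge0 ?mulr_gt0 ?turning_gt0 // ltW.
Qed.

Lemma face_no_ray f a x : a \in boundary f -> x \in boundary f ->
  0 < det2 (p (bprev a)) (p x) -> ~ 0 < det2 (p x) (p a).
Proof.
move=> af xf ax xa; have [_ _ sep] := pP.
apply: (sep f a (next f x)); rewrite ?boundary_next ?turning_next ?ltW //.
by apply: contraTneq ax => ->; rewrite turning_next det2vv ltxx.
Qed.

End Faces.
(** * The matching of a cone *)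

Section Matching.
Variables (R : realType) (D : dimer).
Implicit Types (a x e E : Q1 D) (f : Q2 D).

Lemma matching_valE (K : nzRingType) (m : {ffun Q1 D -> nat}) a :
  matching_val K m a = (m a)%:R.
Proof. by rewrite ffunE. Qed.

Lemma perfect_matchingP (m : {ffun Q1 D -> nat}) :
  perfect_matching m <-> forall f, (\sum_(a in boundary f) m a)%N = 1%N.
Proof.
have mE f : d1 (matching_val int m) f = (\sum_(a in boundary f) m a)%N%:Z.
  rewrite ffunE [RHS](big_morph Posz PoszD (erefl _)).
  by apply: eq_bigr => a _; rewrite matching_valE natz.
split=> [mP f|mP]; last by apply/ffunP => f; rewrite mE mP ffunE.
by have /ffunP/(_ f) := mP; rewrite mE ffunE => -[].
Qed.

Definition fractional_matching (v : {ffun Q1 D -> R^o}) :=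
  (forall a, 0 <= (v a : R)) /\ d1 v = [ffun => 1].

Lemma fractional_matching_val m :
  perfect_matching m -> fractional_matching (matching_val R m).
Proof.
move=> /perfect_matchingP mP; split=> [a|]; first by rewrite ffunE ler0n.
apply/ffunP => f; rewrite !ffunE; under eq_bigr => a _ do rewrite matching_valE.
by rewrite -natr_sum mP.
Qed.

Lemma fractional_matching_le (v : {ffun Q1 D -> R^o}) f a a' :
  fractional_matching v -> a \in boundary f -> a' \in boundary f -> a != a' ->
  (v a : R) + v a' <= 1.
Proof.
move=> [v0 /ffunP/(_ f)]; rewrite !ffunE => <- af a'f aa'.
rewrite (bigD1 a) //= (bigD1 a') /= ?a'f 1?eq_sym // addrA lerDl.
by apply: sumr_ge0.
Qed.

Lemma bnext_bface a : bnext D a \in boundary (bface_of a).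
Proof. by rewrite -bface_of_bnext bface_ofP. Qed.

Lemma zigzag_degree_le (v : {ffun Q1 D -> R^o}) a : fractional_matching v ->
  pairing v (zz_chain R a) <= #|zz a|%:R.
Proof.
move=> vP; rewrite pairing_zz_chain -sum1_card natr_sum; apply: ler_sum => x _.
by apply: (fractional_matching_le (f := bface_of x) vP);
  rewrite ?bface_ofP ?bnext_bface // eq_sym bvalence.
Qed.

Variable p : Q1 D -> 'rV[R]_2.
Hypothesis pP : turning p.
Hypothesis pcross : forall a a', (0 < det2 (p a) (p a')) = (0 < ncross a a')%N.
Variables c d : Q1 D.
Hypothesis cd : 0 < det2 (p c) (p d).
Hypothesis fan : forall s, 0 < det2 (p c) (p s) -> ~ 0 < det2 (p s) (p d).

Let y := p c + p d.

Definition cone_matching : {ffun Q1 D -> nat} :=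
  [ffun x => ((0 < det2 (p (bprev x)) (p c + p d)) && (0 < det2 (p c + p d) (p x))) : nat].
Local Notation M := cone_matching.

Let cy : det2 (p c) y = det2 (p c) (p d).
Proof. by rewrite det2Dr det2vv add0r. Qed.

Let yd : det2 y (p d) = det2 (p c) (p d).
Proof. by rewrite det2Dl det2vv addr0. Qed.

Let y0 : y != 0.
Proof.
apply: contraTneq cd => y0; rewrite -cy y0 /det2 !mxE mulr0 mulr0 subrr.
by rewrite ltxx.
Qed.

Lemma cone_matchingP x : reflect (0 < det2 (p (bprev x)) y /\ 0 < det2 y (p x)) (M x == 1%N).
Proof. by rewrite ffunE; case: andP => h; constructor. Qed.

Lemma cone_matching_bool x : M x = (M x == 1%N).
Proof. by rewrite ffunE; case: andP. Qed.

(* The opposite of a ray of the fan may meet the cone, the ray itself does not. *)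
Lemma fan_generic e x : 0 < det2 (p e) (p x) -> 0 < det2 (p e) y ->
  det2 (p x) y != 0.
Proof.
move=> ex ey; apply/eqP => xy.
have E1 := det2_pluecker (p e) (p x) (p c) y.
have E2 := det2_pluecker (p e) (p x) (p d) y.
rewrite xy mulr0 sub0r in E1; rewrite xy mulr0 sub0r in E2.
have cx : 0 < det2 (p c) (p x).
  by rewrite det2C -(pmulr_lgt0 _ ey) mulrC mulrN -E1 cy mulr_gt0.
apply: (fan cx); rewrite -(pmulr_rgt0 _ ey) -[X in 0 < X]opprK -E2 oppr_gt0.
by rewrite (det2C _ y) yd mulrN oppr_lt0 mulr_gt0.
Qed.

Lemma cone_matching_face f : exists2 x, x \in boundary f & M x == 1%N.
Proof.
have [a af] : exists a, a \in boundary f.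
  case: f => -[B BP] /=; have /imsetP[a _ ->] := BP; by exists a; exact: porbit_id.
have [x xf [tx xy]] := face_sector pP af y0.
exists x => //; apply/cone_matchingP; split=> //.
(* Otherwise [p (bprev x)] would be a positive multiple of [y], a ray strictly between [c] and
   [d]. *)
rewrite lt_neqAle tx andbT eq_sym; apply/eqP => ty.
have tx0 := turning_gt0 pP x.
have E1 := det2_pluecker (p (bprev x)) (p x) (p c) y.
have E2 := det2_pluecker (p (bprev x)) (p x) (p d) y.
rewrite ty mul0r subr0 in E1; rewrite ty mul0r subr0 in E2.
have xy' : det2 (p x) y < 0 by rewrite det2C oppr_lt0.
apply: (fan (s := bprev x)).
  rewrite det2C oppr_gt0 -(nmulr_lgt0 _ xy') -E1 cy mulr_gt0 //.
rewrite -(nmulr_llt0 _ xy') -E2 (det2C _ y) yd mulrN oppr_lt0 mulr_gt0 //.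
Qed.

Lemma cone_matching_uniq f x x' : x \in boundary f -> x' \in boundary f ->
  M x == 1%N -> M x' == 1%N -> x = x'.
Proof.
move=> xf x'f /cone_matchingP[h1 h2] /cone_matchingP[h3 h4].
exact: (face_sector_uniq pP xf x'f h1 h2).
Qed.

Lemma cone_matching_perfect : perfect_matching M.
Proof.
apply/perfect_matchingP => f; have [x xf /eqP Mx] := cone_matching_face f.
rewrite (bigD1 x) //= Mx big1 // => x' /andP[x'f xx'].
rewrite cone_matching_bool; case: eqP => // /eqP Mx'.
by rewrite (cone_matching_uniq xf x'f _ Mx') ?Mx ?eqxx // in xx'.
Qed.

(** The sector contains [y]. An end of the cone outside it either makes [bprev x] or [x] a ray
    strictly between [c] and [d], or contradicts the signs in [dE], the expansion of [y] along the
    sides of the sector. *)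
Lemma cone_matching_cone x : M x == 1%N ->
  [/\ 0 <= det2 (p (bprev x)) (p c), 0 <= det2 (p c) (p x),
      0 <= det2 (p (bprev x)) (p d) & 0 <= det2 (p d) (p x)].
Proof.
move=> /cone_matchingP[ey yq]; set e := bprev x in ey *.
have eq : 0 < det2 (p e) (p x) := turning_gt0 pP x.
have eyE : det2 (p e) y = det2 (p e) (p c) + det2 (p e) (p d) by rewrite det2Dr.
have yqE : det2 y (p x) = det2 (p c) (p x) + det2 (p d) (p x) by rewrite det2Dl.
have E := det2_cramer (p e) (p x) y.
have dE u : det2 (p e) (p x) * det2 y u = det2 y (p x) * det2 (p e) u + det2 (p e) y * det2 (p x) u.
  by rewrite -det2Zl E det2Dl !det2Zl.
have ec : 0 <= det2 (p e) (p c).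
  rewrite leNgt; apply/negP => ec; apply: (fan (s := e)); first by rewrite det2C oppr_gt0.
  by rewrite eyE in ey; lra.
have dq : 0 <= det2 (p d) (p x).
  rewrite leNgt; apply/negP => dq; apply: (fan (s := x)).
    by rewrite yqE in yq; lra.
  by rewrite det2C oppr_gt0.
have cyE : det2 y (p c) = - det2 (p c) (p d) by rewrite det2C cy.
have ed : 0 <= det2 (p e) (p d).
  rewrite leNgt; apply/negP => ed; apply: (fan (s := x)).
    have := dE (p c); rewrite cyE (det2C (p x)) => H.
    have := mulr_gt0 eq cd; have := mulr_ge0 (ltW yq) ec => h1 h2.
    by rewrite -(pmulr_rgt0 _ ey); lra.
  have := dE (p d); rewrite yd => H.
  have : det2 y (p x) * det2 (p e) (p d) < 0 by rewrite pmulr_rlt0.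
  by have := mulr_gt0 eq cd => h1 h2; rewrite -(pmulr_rgt0 _ ey); lra.
split=> //; rewrite leNgt; apply/negP => cq.
have := dE (p c); rewrite cyE (det2C (p x)) => H.
have h1 := mulr_gt0 eq cd; have h2 := mulr_ge0 (ltW yq) ec.
by have : det2 (p e) y * det2 (p c) (p x) < 0; [rewrite pmulr_rlt0 | lra].
Qed.

(** The sector of such an arrow starts at [c], and its end is not strictly between [c] and [d]; so
    it reaches beyond [y]. *)
Lemma cone_matching_zag x : bprev x \in zz c -> M x = 1%N.
Proof.
move=> xc; apply/eqP/cone_matchingP; have tE := turning_zz pP xc.
have cx : 0 < det2 (p c) (p x) by rewrite -tE turning_gt0.
rewrite tE cy; split=> //; rewrite det2Dl ltr_pwDl //.
by rewrite leNgt; apply/negP => dx; apply: (fan cx); rewrite det2C oppr_gt0.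
Qed.

Lemma cone_matching_zig x : x \in zz d -> M x = 1%N.
Proof.
move=> xd; apply/eqP/cone_matchingP; have xE := turning_zz pP xd.
have td : 0 < det2 (p (bprev x)) (p d) by rewrite -xE turning_gt0.
rewrite xE yd; split=> //; rewrite det2Dr ltr_wpDl //.
by rewrite leNgt; apply/negP => tc; apply: (@fan (bprev x)); rewrite // det2C oppr_gt0.
Qed.

Definition degree (m : {ffun Q1 D -> nat}) a : nat := \sum_(x in zz a) (m x + m (bnext D x)).

Lemma pairing_matching m a : pairing (matching_val R m) (zz_chain R a) = (degree m a)%:R.
Proof.
by rewrite pairing_zz_chain natr_sum; apply: eq_bigr => x _; rewrite !matching_valE natrD.
Qed.

Lemma degree_zag m a : degree m a = (\sum_(x | bprev x \in zz a) (m (bprev x) + m x))%N.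
Proof.
rewrite /degree [RHS](reindex_inj (@perm_inj _ (bnext D))) /=.
by apply: eq_big => x; rewrite bprevK.
Qed.

(** The same arrows grouped by white faces: the odd arrow [x] is followed by the even arrow
    [wnext D x]. *)
Lemma degree_zag_white m a :
  degree m a = (\sum_(x | bprev x \in zz a) (m (wnext D x) + m x))%N.
Proof.
rewrite degree_zag !big_split /=; congr (_ + _)%N.
rewrite (reindex_inj (@perm_inj _ (bnext D))) [RHS](reindex_inj (@perm_inj _ (bnext D))).
rewrite (reindex_inj (@perm_inj _ zz_next)) /=.
by apply: eq_big => x; rewrite ?bprevK ?zz_next_in // zz_nextE.
Qed.

Lemma degree_cone_matching_zag : degree M c = #|zz c|.
Proof.
have := zigzag_degree_le c (fractional_matching_val cone_matching_perfect).
rewrite pairing_matching ler_nat => le; apply/eqP; rewrite eqn_leq le /=.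
rewrite -sum1_card; apply: leq_sum => x xc.
by rewrite [M (bnext D x)]cone_matching_zag ?bprevK // addn1.
Qed.

Lemma degree_cone_matching_zig : degree M d = #|zz d|.
Proof.
have := zigzag_degree_le d (fractional_matching_val cone_matching_perfect).
rewrite pairing_matching ler_nat => le; apply/eqP; rewrite eqn_leq le /=.
by rewrite -sum1_card; apply: leq_sum => x xc; rewrite [M x]cone_matching_zig.
Qed.

(** * Uniqueness of the matching in its class *)

Section Unique.
Variable m : {ffun Q1 D -> nat}.
Hypothesis mP : perfect_matching m.
Hypothesis degm : forall a, degree m a = degree M a.

Let rank E := #|[set e | (0 < det2 (p e) y) && (0 < det2 (p E) (p e))]%SET|.

Lemma matching_le1 f a a' : a \in boundary f -> a' \in boundary f -> a != a' ->
  (m a + m a' <= 1)%N.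
Proof.
move=> af a'f aa'; have := fractional_matching_le (fractional_matching_val mP) af a'f aa'.
by rewrite !matching_valE -natrD lern1.
Qed.

Lemma matching_other f q x : q \in boundary f -> x \in boundary f -> m q = 1%N ->
  x != q -> m x = 0%N.
Proof.
by move=> qf xf mq xq; have := matching_le1 xf qf xq; rewrite mq addn1 ltnS leqn0 => /eqP.
Qed.

Lemma unique_step E : 0 < det2 (p E) y ->
    (forall e, 0 < det2 (p e) y -> 0 < det2 (p E) (p e) ->
       forall x, bprev x \in zz e -> m x = M x) ->
  forall x, bprev x \in zz E -> m x = M x.
Proof.
move=> Ey IH.
(* The sector of [prev f x] ends in the direction of [E], short of [y]. *)
have prevE f x : bprev x \in zz E -> M (prev f x) = 0%N.
  move=> tx; rewrite cone_matching_bool; case: cone_matchingP => // -[_].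
  by rewrite (turning_prev pP) (turning_zz pP tx) det2C oppr_gt0 ltNge (ltW Ey).
have le f x : x \in boundary f -> bprev x \in zz E -> (m (prev f x) + m x <= M x)%N.
  move=> xf tx; have pf : prev f x \in boundary f by rewrite boundary_prev.
  have pE : p (bprev x) = p E := turning_zz pP tx.
  rewrite [M x]cone_matching_bool; case: eqP => Mx; first by apply: (matching_le1 pf xf); exact: prev_neq.
  have [q qf Mq] := cone_matching_face f; have [ky yq] := elimT (cone_matchingP q) Mq.
  have Ex : 0 < det2 (p E) (p x) by rewrite -pE turning_gt0.
  have xy : 0 < det2 (p x) y.
    rewrite lt_neqAle eq_sym (fan_generic Ex Ey) leNgt; apply/negP => yx; apply: Mx.
    by apply/eqP/cone_matchingP; rewrite pE; split=> //; rewrite det2C oppr_gt0.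
  (* The sector of [q] contains [y] and does not overlap that of [x], so it starts strictly between
     [E] and [y], where the induction hypothesis applies. *)
  have Ek : 0 < det2 (p E) (p (bprev q)).
    rewrite ltNge; apply/negP => kE.
    have kE' : 0 <= det2 (p (bprev q)) (p E) by rewrite det2C oppr_ge0.
    have kx : 0 < det2 (p (bprev q)) (p x).
      rewrite -(pmulr_lgt0 _ Ey) det2_pluecker3 ltr_wpDl ?mulr_gt0 //.
      by rewrite mulr_ge0 // ltW.
    apply: (face_no_ray pP qf xf kx); rewrite -(pmulr_lgt0 _ ky) det2_pluecker.
    rewrite (det2C _ (p (bprev q))) (det2C _ y) mulrNN (det2C _ (p (bprev q))) mulrN opprK.
    by rewrite addr_gt0 // mulr_gt0 // turning_gt0.
  have mq : m q = 1%N by rewrite (IH _ ky Ek) ?zz_refl //; apply/eqP.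
  rewrite (matching_other qf xf mq) ?(matching_other qf pf mq) //.
    by apply: contraTneq Mq => <-; rewrite prevE.
  by apply: contraTneq Mq => <-; apply/eqP.
(* Both sides have the same sum over the path by equality of degrees, so the termwise inequalities
   [le] are equalities; the same holds with white faces. *)
have eqb x : bprev x \in zz E -> (m (bprev x) + m x)%N = M x.
  move=> tx; apply/eqP; move: x tx.
  have := degm E; rewrite !degree_zag => degE.
  have leb x : bprev x \in zz E -> (m (bprev x) + m x <= M x ?= iff (m (bprev x) + m x == M x))%N.
    by move=> tx; split=> //; exact: (le (bface_of x) x (bface_ofP x) tx).
  have [_] := leqif_sum leb; rewrite degE.
  have -> : (\sum_(x | bprev x \in zz E) (M (bprev x) + M x))%N = (\sum_(x | bprev x \in zz E) M x)%N.
    by apply: eq_bigr => x tx; rewrite (prevE (bface_of x) x tx).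
  by rewrite eqxx => /esym /forall_inP.
have eqw x : bprev x \in zz E -> (m (wnext D x) + m x)%N = M x.
  move=> tx; apply/eqP; move: x tx.
  have := degm E; rewrite !degree_zag_white => degE.
  have leb x : bprev x \in zz E -> (m (wnext D x) + m x <= M x ?= iff (m (wnext D x) + m x == M x))%N.
    by move=> tx; split=> //; exact: (le (wface_of x) x (wface_ofP x) tx).
  have [_] := leqif_sum leb; rewrite degE.
  have -> : (\sum_(x | bprev x \in zz E) (M (wnext D x) + M x))%N = (\sum_(x | bprev x \in zz E) M x)%N.
    by apply: eq_bigr => x tx; rewrite (prevE (wface_of x) x tx).
  by rewrite eqxx => /esym /forall_inP.
(* The black and the white equality at an odd arrow give its two neighbouring even arrows the same
   value. *)
have const z : z \in zz E -> m z = m E.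
  move: z; apply: zz_ind => // z zE <-.
  have tz : bprev (bnext D z) \in zz E by rewrite bprevK.
  have := eqw _ tz; rewrite -(eqb _ tz) bprevK zz_nextE => /eqP.
  by rewrite eqn_add2r => /eqP.
have [mE|mE] := posnP (m E); first by move=> x tx; rewrite -(eqb x tx) (const _ tx) mE.
have Mzag x : bprev x \in zz E -> 0 < det2 y (p x).
  move=> tx; suff /cone_matchingP[] : M x == 1%N by [].
  have := eqb x tx; rewrite (const _ tx) [M x]cone_matching_bool; case: (M x == 1%N) => //.
  by move/eqP; rewrite addn_eq0 eqn0Ngt mE.
(* Otherwise the two paths cross in an arrow that is odd on [E] and even on [c]; its sector would
   end at [c], before [y], although [Mzag] puts its end after [y]. *)
have Ec : det2 (p E) (p c) <= 0.
  rewrite leNgt; apply/negP => Ec; have := Ec; rewrite pcross => /card_gt0P[x].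
  rewrite finset.inE => /andP[tx xc]; have := Mzag x tx.
  by rewrite (turning_zz pP xc) det2C cy oppr_gt0 ltNge (ltW cd).
(* Shifting [m] along the zigzag of [E] gives a matching of too large a degree
   on the zigzag of [d]. *)
have Ed : det2 (p E) (p d) <= 0.
  rewrite leNgt; apply/negP => Ed.
  have vP : fractional_matching (matching_val R m + zz_cocycle R E).
    split=> [x|]; last by rewrite linearD /= (fractional_matching_val mP).2 d1_zz_cocycle addr0.
    rewrite !ffunE; have [/const mx|_] := boolP (x \in zz E).
      have : (1 <= m x)%N by rewrite mx.
      rewrite -(ler_nat R) => h.
      by rewrite addrCA; apply: addr_ge0; [exact: ler0n | rewrite subr_ge0].
    by rewrite subr0 addr_ge0.
  have := zigzag_degree_le d vP; rewrite pairingDl pairing_matching degm degree_cone_matching_zig.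
  rewrite gerDl pairing_cocycle_chain; have dE : ncross d E = 0%N.
    apply/eqP; rewrite -leqn0 leqNgt -pcross det2C oppr_gt0 -leNgt; exact: ltW.
  by rewrite dE subr0 leNgt ltr0n -pcross Ed.
by have := Ey; rewrite det2Dr ltNge -[0]addr0 lerD.
Qed.

(** Induction on the number of arrows with direction strictly between [E] and [y]. The arrow [q] of
    a face chosen by [M] is odd on a path covered by the induction, so [m q = 1], which fixes [m] on
    that face. *)
Lemma cone_matching_determined : m = M.
Proof.
have half n : forall E, (rank E < n)%N -> 0 < det2 (p E) y ->
    forall x, bprev x \in zz E -> m x = M x.
  elim: n => // n IH E rE Ey; apply: (unique_step Ey) => e ey Ee.
  apply: IH => //; apply: leq_trans (rE : (rank E <= n)%N).
  apply/proper_card/properP; split.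
    apply/fintype.subsetP => s; rewrite !finset.inE => /andP[sy es].
    by rewrite sy (det2_trans Ey ey sy Ee es).
  by exists e; rewrite !finset.inE ?ey ?Ee // det2vv ltxx andbF.
apply/ffunP => x; have [q qf Mq] := cone_matching_face (bface_of x).
have [ky _] := elimT (cone_matchingP q) Mq.
have mq : m q = 1%N by rewrite (half _ _ (leqnn _) ky) ?zz_refl //; apply/eqP.
have [->|xq] := eqVneq x q; first by rewrite mq; apply/esym/eqP.
rewrite (matching_other qf (bface_ofP x) mq xq) cone_matching_bool.
case: eqP => // /eqP Mx; move: xq.
by rewrite (cone_matching_uniq (bface_ofP x) qf Mx Mq) eqxx.
Qed.

End Unique.
End Matching.
(** * Vertices of the matching polygon *)

Section Gordan.
Variables (R : realType) (T : eqType).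
Implicit Types (s : seq T) (v : T -> 'rV[R]_2).

Lemma seq_argmax (l : T -> R) s i : i \in s ->
  exists2 j, j \in s & forall k, k \in s -> l k <= l j.
Proof.
elim: s i => // a s IH i _; case: s IH => [|b s] IH.
  by exists a; rewrite ?mem_head // => k; rewrite inE => /eqP ->.
have [j js jmax] := IH b (mem_head b s).
have [aj|ja] := leP (l a) (l j).
  exists j; rewrite 1?inE ?js ?orbT // => k; rewrite inE => /orP[/eqP ->//|].
  exact: jmax.
exists a; rewrite ?mem_head // => k; rewrite inE => /orP[/eqP ->//|/jmax].
by move=> /le_trans; apply; exact: ltW.
Qed.

Lemma det2_pos_ex (u : 'rV[R]_2) : u != 0 -> exists h, 0 < det2 h u.
Proof.
move=> u0; exists (\row_i (if i == 0 then u 0 1 else - u 0 0)).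
rewrite /det2 !mxE /= mulNr opprK -!expr2 lt_neqAle addr_ge0 ?sqr_ge0 // andbT eq_sym.
apply: contra u0; rewrite paddr_eq0 ?sqr_ge0 // !sqrf_eq0 => /andP[/eqP u1 /eqP u2].
apply/eqP/rowP => i; rewrite !mxE.
by have /orP[/eqP->|/eqP->] : (i == 0) || (i == 1); first by case: i => -[|[|]].
Qed.

(* Gordan's alternative; in the plane three vectors suffice (Caratheodory). *)
Lemma gordan_plane s v :
  (exists f, forall i, i \in s -> 0 < det2 f (v i)) \/
  (exists i j k : T, [/\ i \in s, j \in s & k \in s] /\
   exists a b c : R, [/\ 0 < a, 0 <= b, 0 <= c & a *: v i + b *: v j + c *: v k = 0]).
Proof.
elim: s => [|d s [[f fP]|]]; first by left; exists 0.
  2: move=> [i [j [k [[is_ js ks] H]]]]; right; exists i, j, k.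
  2: by rewrite !in_cons is_ js ks !orbT.
have [d0|d0] := eqVneq (v d) 0.
  right; exists d, d, d; rewrite !mem_head; split=> //; exists 1, 0, 0.
  by rewrite d0 !scaler0 !addr0.
have [fd|fd] := ltP 0 (det2 f (v d)).
  by left; exists f => i; rewrite inE => /orP[/eqP ->|/fP].
case: s fP => [|i0 s'] fP.
  by left; have [h hd] := det2_pos_ex d0; exists h => i; rewrite inE => /eqP ->.
set s := i0 :: s' in fP *; have i0s : i0 \in s := mem_head i0 s'.
pose phi i := det2 f (v i); pose del := - phi d.
have del0 : 0 <= del by rewrite oppr_ge0.
(* Combinations of [v d] and [v i] with nonnegative coefficients on which [f] vanishes: they all lie
   on one line, and their signs along it decide between the alternatives. *)
pose k i := phi i *: v d + del *: v i.
have fk i : det2 f (k i) = 0 by rewrite det2Dr !det2Zr /del /phi; ring.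
have [k0|k0] := eqVneq (k i0) 0.
  right; exists d, i0, i0; split; first by split; rewrite ?mem_head // in_cons i0s orbT.
  by exists (phi i0), del, 0; rewrite scale0r addr0 -/(k i0) (fP _ i0s).
have [h hk] := det2_pos_ex k0.
have [[i [is_ hi]]|none] := pselect (exists i, i \in s /\ det2 h (k i) <= 0).
  right; exists d, i, i0; split; first by split; rewrite ?mem_head // in_cons ?is_ ?i0s orbT.
  pose rho := - (det2 h (k i) / det2 h (k i0)).
  have rho0 : 0 <= rho by rewrite oppr_ge0 mulr_le0_ge0 // invr_ge0 ltW.
  exists (phi i + rho * phi i0), del, (rho * del); split=> //.
  - by rewrite ltr_pwDl ?fP // mulr_ge0 // ltW // fP.
  - exact: mulr_ge0.
  have -> : (phi i + rho * phi i0) *: v d + del *: v i + (rho * del) *: v i0 =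
     k i + rho *: k i0 by apply/rowP => l; rewrite !mxE; ring.
  have fh : det2 f h != 0.
    apply/eqP => fh.
    have [f' f'i] : exists u, det2 f u != 0 by exists (v i0); rewrite gt_eqF // fP.
    have := det2_cramer f f' (k i0); rewrite fk scale0r addr0 => E.
    have := det2_cramer f f' h; rewrite fh scale0r addr0 => E'.
    have : det2 (det2 f f' *: h) (det2 f f' *: k i0) = 0.
      by rewrite E E' det2Zl det2Zr det2vv !mulr0.
    rewrite det2Zl det2Zr => /eqP; rewrite !mulf_eq0 (negPf f'i) /=.
    by rewrite gt_eqF.
  apply: (scalerI fh); rewrite scaler0 det2_cramer det2Dr det2Zr !fk mulr0 addr0.
  rewrite scale0r addr0 (det2C _ h) det2Dr det2Zr /rho.
  by rewrite mulNr divfK ?gt_eqF // subrr oppr0 scale0r.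
have hpos i : i \in s -> 0 < det2 h (k i).
  by move=> is_; rewrite ltNge; apply/negP => hi; apply: none; exists i.
pose l i := - det2 h (v i) / phi i.
have [j js jmax] := seq_argmax l i0s.
(* [h + mu *: f] is positive on [s] when [mu] exceeds every [l i], and on [d] by the second
   condition; [hpos] at the maximiser [j] makes the two compatible. *)
left; have [mu [mu1 mu2]] : exists mu, l j < mu /\ 0 < det2 h (v d) - mu * del.
  have phij : 0 < phi j by exact: fP.
  have := hpos j js; rewrite det2Dr !det2Zr => hj.
  have [del00|delp] := eqVneq del 0.
    exists (l j + 1); rewrite ltrDl ltr01 del00 mulr0 subr0; split=> //.
    by move: hj; rewrite del00 mul0r addr0 pmulr_rgt0.
  have delgt : 0 < del by rewrite lt_neqAle eq_sym delp.
  have lt : l j < det2 h (v d) / del.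
    by rewrite /l ltr_pdivlMr // mulrAC ltr_pdivrMr //; lra.
  exists ((l j + det2 h (v d) / del) / 2); split; first by lra.
  rewrite subr_gt0 -ltr_pdivlMr //; lra.
exists (h + mu *: f) => i; rewrite in_cons det2Dl det2Zl => /orP[/eqP -> | is_].
  by rewrite -/(phi d) -[phi d]opprK -/del mulrN.
have phii : 0 < phi i by exact: fP.
have : l i < mu by apply: le_lt_trans (jmax i is_) mu1.
by rewrite /l ltr_pdivrMr //; rewrite -/(phi i); lra.
Qed.

End Gordan.

(** * Completeness of the global fan *)

Section FanComplete.
Variables (R : realType) (D : dimer) (p : Q1 D -> 'rV[R]_2).
Hypothesis pP : turning p.

Definition adjacent c d := 0 < det2 (p c) (p d) /\
  forall s, 0 < det2 (p c) (p s) -> ~ 0 < det2 (p s) (p d).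

(** Start from a sector at some face that contains [y]. A ray strictly inside cuts it in two; the
    part containing [y] has fewer rays inside. *)
Lemma adjacent_ex (y : 'rV[R]_2) : (exists a : Q1 D, True) ->
  exists c d, [/\ adjacent c d, 0 <= det2 (p c) y & 0 <= det2 y (p d)].
Proof.
move=> [a _]; have [c0 [d0 [cd cy yd]]] : exists c d,
    [/\ 0 < det2 (p c) (p d), 0 <= det2 (p c) y & 0 <= det2 y (p d)].
  have [y0|y0] := eqVneq y 0.
    exists (bprev a), a; rewrite y0 (turning_gt0 pP).
    by rewrite det20l det20r.
  have [x _ [tx xy]] := face_sector pP (bface_ofP a) y0.
  by exists (bprev x), x; rewrite (turning_gt0 pP) tx ltW.
pose N c d := #|[set s | (0 < det2 (p c) (p s)) && (0 < det2 (p s) (p d))]%SET|.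
have [n] := ubnP (N c0 d0); elim: n c0 d0 cd cy yd => // n IH c d cd cy yd.
rewrite ltnS => nN.
have [[s [cs sd]]|none] := pselect (exists s, 0 < det2 (p c) (p s) /\ 0 < det2 (p s) (p d)); last first.
  by exists c, d; split=> //; split=> // s cs sd; apply: none; exists s.
have [ys|ys] := leP 0 (det2 y (p s)).
  apply: (IH c s) => //; apply: leq_trans nN; apply/proper_card/properP; split.
    apply/fintype.subsetP => t; rewrite !finset.inE => /andP[ct ts]; rewrite ct /=.
    rewrite -(pmulr_lgt0 _ cs) (_ : _ * _ =
      det2 (p t) (p s) * det2 (p c) (p d) + det2 (p c) (p t) * det2 (p s) (p d)).
      by rewrite addr_gt0 // mulr_gt0.
    by rewrite /det2; ring.
  by exists s; rewrite !finset.inE ?cs ?sd // det2vv ltxx andbF.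
apply: (IH s d) => //; first by rewrite det2C oppr_ge0 ltW.
apply: leq_trans nN; apply/proper_card/properP; split.
  apply/fintype.subsetP => t; rewrite !finset.inE => /andP[st td]; rewrite td andbT.
  rewrite -(pmulr_lgt0 _ sd) (_ : _ * _ =
    det2 (p c) (p s) * det2 (p t) (p d) + det2 (p c) (p d) * det2 (p s) (p t)).
    by rewrite addr_gt0 // mulr_gt0.
  by rewrite /det2; ring.
by exists s; rewrite !finset.inE ?cs ?sd // det2vv ltxx.
Qed.

End FanComplete.
Lemma barycenter (R : realType) (V : lmodType R) (x y z m : V) (a b c : R) :
    0 < a + b + c -> b + c != 0 -> a *: x + b *: y + c *: z = (a + b + c) *: m ->
  m = (a / (a + b + c)) *: x +
      (1 - a / (a + b + c)) *: ((b / (b + c)) *: y + (c / (b + c)) *: z).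
Proof.
move=> /lt0r_neq0 abc bc E; apply: (scalerI abc).
rewrite -E scalerDr !scalerA scalerDr !scalerA addrA.
by congr (_ *: _ + _ *: _ + _ *: _); field; rewrite ?bc ?abc.
Qed.

(** * Extremal matchings and cones *)

Section Extremal.
Variables (R : realType) (D : dimer) (w : Q1 D -> 'rV[R]_2).
Hypothesis wP : turning w.
Variable a0 : Q1 D.
Implicit Types (m : {ffun Q1 D -> nat}) (a : Q1 D).
Local Notation p := (@pt R D a0).
Let pP : turning p := turning_pt wP a0.
Let pcross := det2_pt_gt0 wP a0.

(** Nonnegativity and the face sums survive convex combinations, so the degree bound extends from
    the matchings to the whole polygon. *)
Lemma matching_polygon_fractional (x : C1d D R) : matching_polygon R x ->
  exists2 v, fractional_matching v & x = cochain_class v.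
Proof.
move=> [n [P [t [PS t0 t1 ->]]]].
pose m i := projT1 (cid2 (PS i)).
have mP i : perfect_matching (m i) by rewrite /m; case: cid2.
have mE i : P i = cochain_class (matching_val R (m i)) by rewrite /m; case: cid2.
exists (\sum_i t i *: matching_val R (m i)); last first.
  rewrite (big_morph _ (@cochain_classD D R) (linear0 _)).
  by apply: eq_bigr => i _; rewrite mE cochain_classZ.
split=> [a|].
  rewrite sum_ffunE; apply: sumr_ge0 => i _; rewrite ffunE.
  by apply: mulr_ge0 => //; have [] := fractional_matching_val R (mP i).
rewrite linear_sum /=; apply/ffunP => f; rewrite sum_ffunE ffunE -t1.
apply: eq_bigr => i _; rewrite linearZ /= ffunE.
by rewrite (fractional_matching_val R (mP i)).2 ffunE [_ *: _]mulr1.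
Qed.

Lemma cone_matching_extremal c d : adjacent p c d -> extremal R (cone_matching p c d).
Proof.
move=> [cd fan]; set M := cone_matching p c d.
have MP : perfect_matching M := cone_matching_perfect pP cd fan.
have Mfrac := fractional_matching_val R MP.
split=> //; split.
  exists 1%N, (fun=> matching_point R M), (fun=> 1); split=> // [_||].
  - by exists M.
  - by rewrite big_ord1.
  - by rewrite big_ord1 scale1r.
move=> y z t /matching_polygon_fractional[v vP ->] /matching_polygon_fractional[u uP ->].
move=> /andP[t0 t1] E.
have degE a : degree M a = #|zz a| ->
    pairing v (zz_chain R a) = #|zz a|%:R /\ pairing u (zz_chain R a) = #|zz a|%:R.
  move=> degM; have Ea : pairing (matching_val R M) (zz_chain R a) =
      pairing (t *: v + (1 - t) *: u) (zz_chain R a).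
    apply: pairing_cochain_class; first exact: bd1_zz_chain.
    by rewrite cochain_classD !cochain_classZ.
  rewrite pairing_matching degM pairingDl !pairingZl in Ea.
  have vle := zigzag_degree_le a vP; have ule := zigzag_degree_le a uP.
  have t1' : 0 < 1 - t by rewrite subr_gt0.
  have := ler_wpM2l (ltW t0) vle; have := ler_wpM2l (ltW t1') ule => h1 h2.
  have e1 : t * pairing v (zz_chain R a) = t * #|zz a|%:R by lra.
  have e2 : (1 - t) * pairing u (zz_chain R a) = (1 - t) * #|zz a|%:R by lra.
  split; first by apply: (mulfI (lt0r_neq0 t0)).
  by apply: (mulfI (lt0r_neq0 t1')).
have [vc uc] := degE c (degree_cone_matching_zag pP cd fan).
have [vd ud] := degE d (degree_cone_matching_zig pP cd fan).
have eqM v' : fractional_matching v' -> pairing v' (zz_chain R c) = #|zz c|%:R ->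
    pairing v' (zz_chain R d) = #|zz d|%:R -> cochain_class v' = matching_point R M.
  move=> v'P v'c v'd; apply/cochain_classP.
  apply: (coboundary_of_two wP (a0 := a0) (c := c) (d := d)); first by rewrite gt_eqF.
  - by rewrite linearB /= v'P.2 Mfrac.2 subrr.
  - rewrite pairingDl pairingNl v'c pairing_matching.
    by rewrite (degree_cone_matching_zag pP cd fan) subrr.
  - rewrite pairingDl pairingNl v'd pairing_matching.
    by rewrite (degree_cone_matching_zig pP cd fan) subrr.
by split; apply: eqM.
Qed.

Lemma matching_pointP m m' : perfect_matching m -> perfect_matching m' ->
  degree m (bprev a0) = degree m' (bprev a0) -> degree m a0 = degree m' a0 ->
  matching_point R m = matching_point R m'.
Proof.
move=> mP m'P e1 e2; apply/cochain_classP.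
apply: (coboundary_of_two wP (a0 := a0) (c := bprev a0) (d := a0)).
- by rewrite gt_eqF // (turning_gt0 pP).
- by rewrite linearB /= !(fractional_matching_val R _).2 ?subrr.
- by rewrite pairingDl pairingNl !pairing_matching e1 subrr.
- by rewrite pairingDl pairingNl !pairing_matching e2 subrr.
Qed.

Lemma matching_point_degree m m' a :
  matching_point R m = matching_point R m' -> degree m a = degree m' a.
Proof.
move=> /(pairing_cochain_class (bd1_zz_chain R a)); rewrite !pairing_matching.
by move/eqP; rewrite eqr_nat => /eqP.
Qed.

(** Perfect matchings take the values 0 and 1 only; coding them by sets of arrows supplies the
    finite list that Gordan's alternative requires. *)
Let code (A : {set Q1 D}) : {ffun Q1 D -> nat} := [ffun a => (a \in A) : nat].

Lemma perfect_matching_code m : perfect_matching m -> exists A, m = code A.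
Proof.
move=> mP; exists [set a | m a == 1%N]%SET; apply/ffunP => a; rewrite ffunE finset.inE.
have := matching_le1 R mP (bface_ofP a) (bnext_bface a).
rewrite eq_sym (bvalence a) => /(_ isT); case: (m a) => [|[|k]] //=.
Qed.

Lemma extremal_cone_matching m : extremal R m ->
  exists c d, adjacent p c d /\ m = cone_matching p c d.
Proof.
move=> [mP [_ mV]].
(* Position relative to [m], in the degrees along the two paths through [a0]; by [matching_pointP]
   it is 0 only for the class of [m]. *)
pose v (A : {set Q1 D}) : 'rV[R]_2 := \row_i (if i == 0
  then (degree (code A) (bprev a0))%:R - (degree m (bprev a0))%:R
  else (degree (code A) a0)%:R - (degree m a0)%:R).
have v0 A : perfect_matching (code A) -> v A = 0 ->
    matching_point R (code A) = matching_point R m.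
  move=> AP /rowP vA; have := vA 0; have := vA 1; rewrite !mxE /= => /eqP e1 /eqP e0.
  rewrite !subr_eq0 !eqr_nat in e0 e1.
  by apply: matching_pointP => //; apply/eqP.
have v0' A : matching_point R (code A) = matching_point R m -> v A = 0.
  move=> E; apply/rowP => i; rewrite !mxE !(matching_point_degree _ E) !subrr.
  by case: ifP.
pose s := [seq A <- enum {: {set Q1 D}} | `[< perfect_matching (code A) >] & v A != 0].
have sP A : A \in s -> perfect_matching (code A) /\ v A != 0.
  by rewrite mem_filter => /andP[/andP[/asboolP ? ?] _].
(* The second alternative makes the class of [m] a barycenter of at most three others, the first of
   them different from it, so [m] is no vertex. *)
have [[f fP]|[i [j [k [[/sP[iP vi] /sP[jP _] /sP[kP _]] H]]]]] := gordan_plane s v; last first.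
  have [a [b [c [a_gt b_ge c_ge E]]]] := H.
  have abc : 0 < a + b + c by lra.
  have E1 : a *: matching_point R (code i) + b *: matching_point R (code j)
      + c *: matching_point R (code k) = (a + b + c) *: matching_point R m.
    rewrite /matching_point -!cochain_classZ -!cochain_classD; apply/cochain_classP.
    apply: (coboundary_of_two wP (a0 := a0) (c := bprev a0) (d := a0)).
    - by rewrite gt_eqF // (turning_gt0 pP).
    - rewrite !linearB !linearD !linearZ /= !(fractional_matching_val R _).2 //.
      by rewrite !scalerDl !scalerN -!opprD subrr.
    - have /rowP/(_ 0) := E; rewrite !mxE /= => h.
      rewrite !pairingDl pairingNl !pairingZl !pairing_matching; lra.
    - have /rowP/(_ 1) := E; rewrite !mxE /= => h.
      rewrite !pairingDl pairingNl !pairingZl !pairing_matching; lra.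
  have polyP A : perfect_matching (code A) -> matching_polygon R (matching_point R (code A)).
    move=> AP; exists 1%N, (fun=> matching_point R (code A)), (fun=> 1); split=> // [_||].
    - by exists (code A).
    - by rewrite big_ord1.
    - by rewrite big_ord1 scale1r.
  exfalso; have [bc0|bc0] := eqVneq (b + c) 0.
    have [b0 c0] : b = 0 /\ c = 0 by lra.
    by move: E; rewrite b0 c0 !scale0r !addr0 => /eqP; rewrite scaler_eq0 gt_eqF //= (negPf vi).
  have bc : 0 < b + c by rewrite lt_neqAle eq_sym bc0 addr_ge0.
  pose z := (b / (b + c)) *: matching_point R (code j) + (c / (b + c)) *: matching_point R (code k).
  have zP : matching_polygon R z.
    exists 2%N, (fun l => if l == 0 then matching_point R (code j) else matching_point R (code k)),
      (fun l => if l == 0 then b / (b + c) else c / (b + c)); split.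
    - by move=> l; case: ifP => _; [exists (code j) | exists (code k)].
    - by move=> l; case: ifP => _; apply: divr_ge0 => //; exact: ltW.
    - by rewrite !big_ord_recl big_ord0 /= addr0; field.
    - by rewrite !big_ord_recl big_ord0 /= addr0.
  have t01 : 0 < a / (a + b + c) < 1.
    by rewrite divr_gt0 //= ltr_pdivrMr // mul1r; lra.
  have zE : matching_point R m = (a / (a + b + c)) *: matching_point R (code i) +
      (1 - a / (a + b + c)) *: z.
    exact: barycenter abc bc0 E1.
  have [mi _] := mV _ _ _ (polyP i iP) zP t01 zE.
  by rewrite (v0' i mi) eqxx in vi.
(* Pairing with [z] is minus the functional [det2 f] on the vectors [v A], so [m] beats every
   matching of another class on [z]. The matching [M] of a cone containing [z] is maximal on both
   ends of the cone, hence on [z], and must share the class of [m]. *)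
have [z [zE dz]] : exists z : {ffun Q1 D -> R^o},
    z = f 0 1 *: zz_chain R (bprev a0) - f 0 0 *: zz_chain R a0 /\ bd1 z = 0.
  by eexists; split; [reflexivity | rewrite -scaleNr linearD !linearZ /= !bd1_zz_chain !scaler0 addr0].
have [c [d [adj cy yd]]] := adjacent_ex pP (coords a0 z) (ex_intro _ a0 I).
exists c, d; split=> //; have [cd fan] := adj.
set M := cone_matching p c d; have MP : perfect_matching M := cone_matching_perfect pP cd fan.
have [A AE] := perfect_matching_code MP.
suff mM : matching_point R m = matching_point R M.
  apply: (cone_matching_determined pP pcross cd fan mP) => a.
  exact: matching_point_degree mM.
pose u := matching_val R M - matching_val R m.
have du : d1 u = 0 by rewrite linearB /= !(fractional_matching_val R _).2 // subrr.
have degle a : degree M a = #|zz a| -> 0 <= pairing u (zz_chain R a).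
  move=> Ma; rewrite pairingDl pairingNl pairing_matching Ma subr_ge0.
  exact: zigzag_degree_le (fractional_matching_val R mP).
have uc := degle c (degree_cone_matching_zag pP cd fan).
have ud := degle d (degree_cone_matching_zig pP cd fan).
have cd0 : det2 (p c) (p d) != 0 by rewrite gt_eqF.
have uz : 0 <= pairing u z.
  rewrite (@pairing_chain_class D R u z
    ((det2 (coords a0 z) (p d) / det2 (p c) (p d)) *: zz_chain R c +
     (det2 (p c) (coords a0 z) / det2 (p c) (p d)) *: zz_chain R d) du).
    by rewrite pairingDr !pairingZr addr_ge0 // mulr_ge0 // divr_ge0 // ltW.
  apply: (coords_inj wP (a0 := a0)) => //; last first.
    by rewrite coordsD !coordsZ; exact: det2_decomp.
  by rewrite linearD !linearZ /= !bd1_zz_chain !scaler0 addr0.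
have AP : perfect_matching (code A) by rewrite -AE.
rewrite AE; apply/esym/v0 => //; apply/eqP/negPn/negP => vA.
have As : A \in s by rewrite mem_filter vA asboolT //= mem_enum.
have := fP A As; rewrite /det2 !mxE /= -AE.
move: uz; rewrite /u zE pairingDr pairingNr !pairingZr !pairingDl !pairingNl !pairing_matching.
by lra.
Qed.

End Extremal.
(** * The zigzag fans *)

Section Cones.
Variables (R : realType) (V : lmodType R).
Implicit Types u v : V.

Lemma cone_l u v : cone u v u.
Proof. by exists 1, 0; rewrite scale1r scale0r addr0 ler01 lexx. Qed.

Lemma cone_r u v : cone u v v.
Proof. by exists 0, 1; rewrite scale1r scale0r add0r ler01 lexx. Qed.

Lemma cone_subset u v u' v' : cone u' v' u -> cone u' v' v -> cone u v `<=` cone u' v'.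
Proof.
move=> [a [b [a0 b0 ->]]] [c [d [c0 d0 ->]]] _ [s [t [s0 t0 ->]]].
exists (s * a + t * c), (s * b + t * d); split; rewrite ?addr_ge0 ?mulr_ge0 //.
by rewrite !scalerDr !scalerA !scalerDl addrACA.
Qed.

Lemma coneC u v : cone u v = cone v u.
Proof. by apply/seteqP; split; apply: cone_subset; rewrite ?[cone _ _ _]cone_l //;
  [exact: cone_r | exact: cone_l | exact: cone_r | exact: cone_l]. Qed.

Lemma ray_refl u : ray u u.
Proof. by exists 1; rewrite ?ler01 ?scale1r. Qed.

Lemma ray_cone u v u' v' : ray u = ray u' -> ray v = ray v' -> cone u v = cone u' v'.
Proof.
have half (w1 w2 w1' w2' : V) : ray w1 = ray w1' -> ray w2 = ray w2' ->
    cone w1 w2 `<=` cone w1' w2'.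
  move=> E1 E2; apply: cone_subset.
    have : ray w1' w1 by rewrite -E1; exact: ray_refl.
    by move=> [t t0 ->]; exists t, 0; rewrite scale0r addr0.
  have : ray w2' w2 by rewrite -E2; exact: ray_refl.
  by move=> [t t0 ->]; exists 0, t; rewrite scale0r add0r.
by move=> E1 E2; apply/seteqP; split; apply: half.
Qed.

Lemma lin_indep_ray u v : lin_indep u v -> ray u <> ray v.
Proof.
move=> uv E; have : ray v u by rewrite -E; exact: ray_refl.
move=> [t _ ut]; have [] := uv 1 (- t); first by rewrite scale1r scaleNr -ut subrr.
by move=> /eqP; rewrite oner_eq0.
Qed.

Lemma lin_indepC u v : lin_indep u v -> lin_indep v u.
Proof. by move=> uv s t; rewrite addrC => /uv[]. Qed.

End Cones.

(** * The cones of the zigzag fans and their arrows *)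

Section Fans.
Variables (R : realType) (D : dimer) (o : Q0 D) (w : Q1 D -> 'rV[R]_2).
Hypothesis wP : turning w.
Hypothesis flowb : forall x y, cover_arrow o x -> bface x y ->
  cover_head x = cover_tail y -> y = tbnext x.
Hypothesis floww : forall x y, cover_arrow o x -> wface x y ->
  cover_head x = cover_tail y -> y = twnext x.
Variable a0 : Q1 D.
Implicit Types (a c d s : Q1 D) (f : Q2 D).
Local Notation p := (@pt R D a0).
Let pP : turning p := turning_pt wP a0.
Let bprev_zz a : bprev a \notin zz a := bprev_notin (face_zz wP) (zz_refl a).

Definition zigzag_class a : C1B D R := chain_class (zz_chain R a).
Local Notation X := zigzag_class.

Lemma zigzag_class_zz a x : x \in zz a -> X x = X a.
Proof. by move=> xa; rewrite /X (zz_chain_eq R xa). Qed.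

Lemma flow_class eta n : zigzag_flow o eta ->
  zz_class R eta = X (eta n).1 \/ zz_class R eta = X (bprev (eta n).1).
Proof.
move=> etaP; rewrite (zz_classE flowb floww bprev_zz etaP R).
by have [h|h] := flow_arrow flowb floww etaP n; [left|right]; rewrite -/(X _) (zigzag_class_zz h).
Qed.

Lemma global_fanE : global_fan o R = [set X a | a in setT].
Proof.
apply/seteqP; split=> [_ [eta etaP <-]|_ [a _ <-]].
  by exists (eta 0).1 => //; rewrite (zz_classE flowb floww bprev_zz etaP).
have [g ag] := cover_arrow_ex o a; have [eta [etaP eta0 _]] := flow_ex ag.
by exists eta => //; rewrite (zz_classE flowb floww bprev_zz etaP) eta0.
Qed.

Lemma local_fanE f : local_fan o R f = [set X a | a in [set a | a \in boundary f]].
Proof.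
apply/seteqP; split=> [_ [eta [etaP [n nf]] <-]|_ [a af <-]].
  have [->|->] := flow_class n etaP; first by exists (eta n).1.
  exists (prev f (eta n).1); first by rewrite /= boundary_prev.
  by apply: zigzag_class_zz; rewrite zz_prev zz_refl.
have [g ag] := cover_arrow_ex o a; have [eta [etaP eta0 _]] := flow_ex ag.
exists eta; last by rewrite (zz_classE flowb floww bprev_zz etaP) eta0.
by split=> //; exists 0; rewrite eta0.
Qed.

Lemma pt_neq0 a : p a != 0.
Proof.
have := turning_gt0 pP a; apply: contraTneq => ->.
by rewrite det20r ltxx.
Qed.

Lemma comb_class (s t : R) c d : s *: X c + t *: X d =
  chain_class (s *: zz_chain R c + t *: zz_chain R d).
Proof. by rewrite chain_classD !chain_classZ. Qed.

Lemma coords_comb (s t : R) c d :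
  coords a0 (s *: zz_chain R c + t *: zz_chain R d) = s *: p c + t *: p d.
Proof. by rewrite coordsD !coordsZ. Qed.

Lemma bd1_comb (s t : R) c d : bd1 (s *: zz_chain R c + t *: zz_chain R d) = 0.
Proof. by rewrite linearD !linearZ /= !bd1_zz_chain !scaler0 addr0. Qed.

Lemma cone_class c d s : 0 < det2 (p c) (p d) ->
  cone (X c) (X d) (X s) <-> 0 <= det2 (p c) (p s) /\ 0 <= det2 (p s) (p d).
Proof.
move=> cd; split=> [[a [b [a_ge b_ge]]]|[cs sd]].
  rewrite comb_class => /(coords_class a0); rewrite coords_comb -/(p s) => ->.
  by rewrite det2Dr det2Dl !det2Zr !det2Zl !det2vv !mulr0 add0r addr0 !mulr_ge0 // ltW.
exists (det2 (p s) (p d) / det2 (p c) (p d)), (det2 (p c) (p s) / det2 (p c) (p d)).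
split; try by rewrite divr_ge0 // ltW.
rewrite comb_class; apply: (coords_inj wP (a0 := a0)); rewrite ?bd1_zz_chain ?bd1_comb //.
by rewrite coords_comb -det2_decomp // gt_eqF.
Qed.

Lemma lin_indep_class c d : lin_indep (X c) (X d) <-> det2 (p c) (p d) != 0.
Proof.
split=> [ind|cd s t].
  apply/eqP => cd; have [h hc] := det2_pos_ex (pt_neq0 c).
  (* The linear relation between two parallel vectors, read off with a vector [h] transverse to
     them. *)
  have [] := ind (det2 (p d) h) (- det2 (p c) h); last first.
    by move=> _ /eqP; rewrite oppr_eq0 det2C oppr_eq0 gt_eqF.
  rewrite comb_class -chain_class0.
  apply: (coords_inj wP (a0 := a0)); rewrite ?bd1_comb ?linear0 // coords_comb.
  have -> : coords a0 (0 : {ffun Q1 D -> R^o}) = 0.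
    by apply/rowP => i; rewrite !mxE !pairing0r; case: ifP.
  have ch : det2 (p c) h != 0 by rewrite det2C oppr_eq0 gt_eqF.
  set r := _ + _; have rh : det2 r h = 0 by rewrite det2Dl !det2Zl mulNr mulrC subrr.
  have cr : det2 (p c) r = 0 by rewrite det2Dr !det2Zr det2vv cd !mulr0 addr0.
  by apply: (scalerI ch); rewrite det2_cramer rh cr !scale0r addr0 scaler0.
rewrite comb_class => E.
have : coords a0 (s *: zz_chain R c + t *: zz_chain R d) = coords a0 0.
  by apply: coords_class; rewrite E chain_class0.
have -> : coords a0 (0 : {ffun Q1 D -> R^o}) = 0.
  by apply/rowP => i; rewrite !mxE !pairing0r; case: ifP.
rewrite coords_comb => E0; split.
  have : det2 (s *: p c + t *: p d) (p d) = 0 by rewrite E0 det20l.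
  by rewrite det2Dl !det2Zl det2vv mulr0 addr0 => /eqP; rewrite mulf_eq0 (negPf cd) orbF => /eqP.
have : det2 (p c) (s *: p c + t *: p d) = 0 by rewrite E0 det20r.
by rewrite det2Dr !det2Zr det2vv mulr0 add0r => /eqP; rewrite mulf_eq0 (negPf cd) orbF => /eqP.
Qed.

Definition adjacent_in (A : set (Q1 D)) c d := [/\ A c, A d, 0 < det2 (p c) (p d)
  & forall s, A s -> 0 < det2 (p c) (p s) -> ~ 0 < det2 (p s) (p d)].

Lemma ray_class c s : ray (X c) (X s) -> det2 (p c) (p s) = 0.
Proof.
move=> [t _]; rewrite /zigzag_class -chain_classZ => /(coords_class a0).
by rewrite coordsZ -/(p s) -/(p c) => ->; rewrite det2Zr det2vv mulr0.
Qed.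

Lemma fan_cone_adjacent (A : set (Q1 D)) c d : adjacent_in A c d ->
  fan_cone [set X a | a in A] (X c) (X d) (cone (X c) (X d)).
Proof.
move=> [Ac Ad cd none]; split=> //; [by exists c | by exists d | |].
  by apply/lin_indep_class; rewrite gt_eqF.
move=> _ [s As <-] sE; have [a [b [a_ge b_ge XE]]] := sE.
have [cs sd] := (cone_class s cd).1 sE.
have pE : p s = a *: p c + b *: p d.
  by rewrite -coords_comb; apply: coords_class; rewrite -comb_class -XE.
have [b0|b0] := eqVneq b 0.
  by left; exists a => //; rewrite XE b0 scale0r addr0.
have [a00|a00] := eqVneq a 0.
  by right; exists b => //; rewrite XE a00 scale0r add0r.
exfalso; apply: (none s As); rewrite pE ?det2Dr ?det2Dl ?det2Zr ?det2Zl det2vv mulr0.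
  by rewrite add0r mulr_gt0 // lt_neqAle eq_sym b0.
by rewrite addr0 mulr_gt0 // lt_neqAle eq_sym a00.
Qed.

Lemma adjacent_fan_cone (A : set (Q1 D)) u v t : fan_cone [set X a | a in A] u v t ->
  exists c d, adjacent_in A c d /\ t = cone (X c) (X d).
Proof.
move=> [[c Ac <-] [d Ad <-] ind -> none].
(* Cones do not order their two rays; name them so that they turn positively. *)
wlog cd : c d Ac Ad ind none / 0 < det2 (p c) (p d).
  move=> H; have := (lin_indep_class c d).1 ind; rewrite neq_lt => /orP[dc|cd]; last exact: H.
  rewrite coneC; apply: H => //; first exact: lin_indepC.
    by move=> s As; rewrite coneC => sc; have [] := none s As sc; [right|left].
  by rewrite det2C oppr_gt0.
exists c, d; split=> //; split=> // s As cs sd.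
have : cone (X c) (X d) (X s) by apply/cone_class => //; rewrite !ltW.
move=> sc; have [|/ray_class|/ray_class] := none (X s) _ sc; first by exists s.
  by move=> E; rewrite E ltxx in cs.
by move=> E; rewrite det2C E oppr0 ltxx in sd.
Qed.

Lemma adjacentT c d : adjacent p c d <-> adjacent_in setT c d.
Proof.
split=> [[cd h]|[_ _ cd h]]; split=> // s; first by move=> _; exact: h.
exact: h.
Qed.

Lemma represents_flow eta a : zigzag_flow o eta -> zz_class R eta = X a ->
  represents o eta (ray (X a)).
Proof.
move=> etaP E; split=> //; last by rewrite E.
rewrite (zz_classE flowb floww bprev_zz etaP); apply: primitive_zz_chain.
  exact: (face_zz wP).
exact: (cross_neq0 wP).
Qed.

(** A flow through [x] has the class of [a] or of [bprev a], according to the parity of [x] on it;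
    flows on different rays realise both. *)
Lemma correspondsP f (t : set (C1B D R)) a : corresponds o f t a ->
  a \in boundary f /\ t = cone (X (bprev a)) (X a).
Proof.
move=> [af [u [v [[_ _ ind -> _] [x [e1 [e2 [xa [f1 _ r1] [f2 _ r2] [n1 x1] [n2 x2]]]]]]]]].
split=> //.
have := flow_class n1 f1; have := flow_class n2 f2; rewrite x1 x2 xa.
have := lin_indep_ray ind.
move=> ne [E2|E2] [E1|E1]; rewrite E1 in r1; rewrite E2 in r2.
- by case: ne; rewrite r1 r2.
- exact: ray_cone.
- by rewrite coneC; exact: ray_cone.
- by case: ne; rewrite r1 r2.
Qed.

Lemma corresponds_cone f a : a \in boundary f ->
  two_dim_cone (local_fan o R f) (cone (X (bprev a)) (X a)) /\
  corresponds o f (cone (X (bprev a)) (X a)) a.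
Proof.
move=> af; have pE : X (prev f a) = X (bprev a).
  by apply: zigzag_class_zz; rewrite zz_prev zz_refl.
have fc : fan_cone (local_fan o R f) (X (bprev a)) (X a) (cone (X (bprev a)) (X a)).
  rewrite -pE local_fanE; apply: fan_cone_adjacent; split=> //=.
  - by rewrite boundary_prev.
  - by rewrite (turning_prev pP) (turning_gt0 pP).
  - by move=> s sf; rewrite (turning_prev pP); exact: (face_no_ray pP af sf).
split; first by exists (X (bprev a)), (X a).
split=> //; exists (X (bprev a)), (X a); split=> //.
have [g ag] := cover_arrow_ex o a.
have [e2 [f2 e20 _]] := flow_ex ag.
(* Starting one step earlier on the black face makes the lift of [a] the odd arrow of index 1. *)
have [e1 [f1 e10 e11]] := flow_ex (cover_tbprev ag).
exists (a, g), e1, e2; split=> //.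
- by apply: represents_flow => //; rewrite (zz_classE flowb floww bprev_zz f1) e10.
- by apply: represents_flow => //; rewrite (zz_classE flowb floww bprev_zz f2) e20.
- by exists 1; rewrite e11 tbprevK.
- by exists 0.
Qed.

Lemma cone_matching_subset c d a : adjacent p c d ->
  cone (X c) (X d) `<=` cone (X (bprev a)) (X a) <-> cone_matching p c d a == 1%N.
Proof.
move=> [cd fan]; have ta := turning_gt0 pP a; split=> [sub|/(cone_matching_cone pP cd fan)].
  have [tc ca] := (cone_class c ta).1 (sub _ (cone_l _ _)).
  have [td da] := (cone_class d ta).1 (sub _ (cone_r _ _)).
  (* A nonzero vector is not parallel to both [p c] and [p d], so the sums of two nonnegative
     determinants below are positive. *)
  have nz s : det2 (p s) (p c) = 0 -> det2 (p s) (p d) = 0 -> False.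
    move=> sc sd; have := det2_cramer (p c) (p d) (p s).
    rewrite sd (det2C (p c) (p s)) sc oppr0 !scale0r addr0 => /eqP.
    by rewrite scaler_eq0 gt_eqF //= (negPf (pt_neq0 s)).
  apply/cone_matchingP; rewrite det2Dr det2Dl; split.
    rewrite lt_neqAle addr_ge0 // andbT eq_sym; apply/negP.
    by rewrite paddr_eq0 // => /andP[/eqP h1 /eqP h2]; exact: (nz (bprev a)).
  rewrite lt_neqAle addr_ge0 // andbT eq_sym; apply/negP.
  rewrite paddr_eq0 // => /andP[/eqP h1 /eqP h2]; apply: (nz a).
    by rewrite det2C h1 oppr0.
  by rewrite det2C h2 oppr0.
by move=> [tc ca td da]; apply: cone_subset; apply/cone_class.
Qed.

Lemma matching_of_coneE c d : adjacent p c d ->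
  matching_of_cone o (cone (X c) (X d)) = [ffun a => (cone_matching p c d a)%:R].
Proof.
move=> adj; apply/ffunP => a; rewrite !ffunE.
have atE f : matching_at o f (cone (X c) (X d)) a =
    if a \in boundary f then (cone_matching p c d a)%:R else 0.
  rewrite /matching_at; case: ifPn => af; last first.
    by rewrite asboolF // => -[t [_ _ /correspondsP[af' _]]]; rewrite af' in af.
  rewrite cone_matching_bool; congr (_%:R); congr nat_of_bool; apply/asboolP/idP.
    by move=> [t [_ sub /correspondsP[_ tE]]]; rewrite tE in sub; apply/cone_matching_subset.
  move=> /(cone_matching_subset a adj) sub; have [h1 h2] := corresponds_cone af.
  by exists (cone (X (bprev a)) (X a)).
under eq_bigr do rewrite atE.
(* The black and the white face of an arrow make the same choice about it, which absorbs the factor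
   one half. *)
rewrite -big_mkcond sum_faces -mulr2n -[X in _ * X]mulr_natl mulrA mulVf // mul1r.
by rewrite ffunE.
Qed.

End Fans.

Theorem corollary4p30 (R : realType) (D : dimer) (o : Q0 D)
    (hD : geometrically_consistent R o) (p : {ffun Q1 D -> rat}) :
  (exists m : {ffun Q1 D -> nat},
     extremal R m /\ p = [ffun a => (m a)%:R%R]) <->
  (exists sigma : set (C1B D R),
     two_dim_cone (global_fan o R) sigma /\ p = matching_of_cone o sigma).
Proof.
have [w [wZ wpos wsep flowb floww]] := geometry hD.
have wP : turning w by [].
have [a0 _] := Q0_surj o.
rewrite (global_fanE wP flowb floww); split.
  move=> [m [/(extremal_cone_matching wP a0)[c [d [adj ->]]] ->]].
  exists (cone (zigzag_class R c) (zigzag_class R d)); split.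
    exists (zigzag_class R c), (zigzag_class R d).
    by apply: (fan_cone_adjacent wP); apply/adjacentT; exact: adj.
  by rewrite (matching_of_coneE wP flowb floww adj).
move=> [sigma [[u [v /(adjacent_fan_cone wP a0)[c [d [/adjacentT adj ->]]]]] ->]].
exists (cone_matching (@pt R D a0) c d); split; first exact: (cone_matching_extremal wP).
exact: (matching_of_coneE wP flowb floww adj).
Qed.
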